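(* Let $n\ge 1$, let $\Omega\subset\mathbb{C}^n$ be a bounded domain, let $a\in\Omega$ and let $M>0$. Then for every sufficiently small $\varepsilon>0$ the following holds: for every $w\in\mathbb{C}$ with $|w|<M$ there is a constant $C>0$ (depending, for the given $\Omega$ and $a$, only on $w$ and $\varepsilon$) such that every holomorphic function $f:\Omega\to\mathbb{C}$ whose range omits the values $0$ and $1$ and which satisfies $f(a)=w$ has $$|f(z)|<C\quad\text{for all } z\in\Omega \text{ with } \delta(z)\ge\varepsilon.$$
   Context: A domain is a nonempty connected open set. For $z\in\Omega$, $\delta(z)$ denotes the Euclidean distance from $z$ to the boundary $\partial\Omega$. ''For every sufficiently small $\varepsilon>0$'' means that there is $\varepsilon_0>0$, independent of $w$ and $f$, such that the assertion holds for all $\varepsilon\in(0,\varepsilon_0)$. *)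

(* Defs.v *)
From HB Require Import structures.
From mathcomp Require Import all_boot all_order all_algebra.
From mathcomp Require Import all_classical all_reals all_analysis.
From mathcomp Require Import complex.

Set Implicit Arguments.
Unset Strict Implicit.
Unset Printing Implicit Defensive.

Import Order.TTheory GRing.Theory Num.Theory.
Import numFieldNormedType.Exports.

Local Open Scope classical_set_scope.
Local Open Scope ring_scope.
Local Open Scope complex_scope.

(* R[i] as a normed module over itself; mathcomp-analysis declares this for   *)
(* abstract numeric fields only. 'rV[R[i]]_n then carries the product         *)
(* topology, its library norm being the sup norm.                             *)
HB.instance Definition _ (R : rcfType) := NormedModule.copy R[i] R[i]^o.

Definition is_domain {R : realType} {n : nat} (Omega : set 'rV[R[i]]_n) : Prop :=
  [/\ Omega !=set0, open Omega & connected Omega].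

(* Differentiability is that of the normed modules over R[i]: the             *)
(* differential is R[i]-linear. Values of f outside Omega are irrelevant when *)
(* Omega is open.                                                             *)
Definition holomorphic_on {R : realType} {n : nat} (Omega : set 'rV[R[i]]_n)
    (f : 'rV[R[i]]_n -> R[i]) : Prop :=
  forall z, Omega z -> differentiable f z.

Definition boundary {T : topologicalType} (A : set T) : set T :=
  closure A `\` A°.

Definition euclidean_dist {R : realType} {n : nat} (z w : 'rV[R[i]]_n) : R :=
  Num.sqrt (\sum_(i < n) ComplexField.Normc.normc (z ord0 i - w ord0 i) ^+ 2).

(* inf returns 0 on the empty set, so this is meaningful only when Omega has  *)
(* a nonempty boundary, e.g. when Omega is bounded and nonempty and n > 0.    *)
Definition dist_to_boundary {R : realType} {n : nat} (Omega : set 'rV[R[i]]_n)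
    (z : 'rV[R[i]]_n) : R :=
  inf [set euclidean_dist z b | b in boundary Omega].

(* Main.v *)
(* A holomorphic f : disc -> C \ {0, 1} is controlled by Ahlfors' method. If *)
(* log lambda is C^2 with Laplacian >= 4 k lambda^2 and z maximizes            *)
(* lambda(f) |f'| (r^2 - |z|^2), then at z the Laplacian of the logarithm of   *)
(* this product is <= 0; log |f'| being harmonic, this bounds the maximum.     *)
(* The first metric is Robinson's                                              *)
(*   [(1 + |w|^(1/3)) (1 + |w-1|^(1/3))]^(1/2) / (|w| |w-1|)^(5/6),            *)
(* negatively curved on all of C \ {0, 1} but incomplete at infinity. It      *)
(* bounds |f'| where |f| <= 2, which is the boundary control needed to run the *)
(* same argument where |f| > 2 with 1 / (|w| log |w|), complete at infinity.   *)
(* Hence log log |f| is Lipschitz where |f| >= 2 (Schottky's theorem). The set *)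
(* of points of Omega at which the functions f with f(a) = w are uniformly     *)
(* bounded is then open and closed, hence Omega, and compactness concludes.    *)
(* The needed smoothness of f (f' is holomorphic) comes from Goursat's lemma   *)
(* and Cauchy's formula on squares.                                            *)
Require Import Defs.
From mathcomp Require Import all_boot all_order all_algebra.
From mathcomp Require Import all_classical all_reals all_analysis.
From mathcomp Require Import complex ring lra.

Set Implicit Arguments.
Unset Strict Implicit.
Unset Printing Implicit Defensive.

Import Order.TTheory GRing.Theory Num.Theory.
Import numFieldNormedType.Exports.

Local Open Scope classical_set_scope.
Local Open Scope ring_scope.
Local Open Scope complex_scope.

(* Real-valued modulus; [Re] and [Im] would otherwise be those of Num. *)
Local Notation N := ComplexField.Normc.normc.
Local Notation Re := complex.Re.
Local Notation Im := complex.Im.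

(** * Complex modulus and real derivatives *)

(** The core is a one-variable theorem of Schottky, [schottky]: if f omits 0 and 1 on |z| < 4, a
    bound for |f(0)| bounds |f| on |z| <= 1, with a constant independent of f. For a density lambda
    of negative curvature, the maximum of lambda(f) |f'| (4 - |z|^2) over |z| < 2 is bounded,
    because its logarithm has nonpositive Laplacian there ([ahlfors_bound]). Robinson's explicit
    density avoids the modular function and yields [rob_bound], which is exploited where |f| <= 2.
    That is enough to start the same argument on |f| > 2 with the cusp density 1 / (|w| ln |w|^2),
    whence [cusp_bound] and [derivative_bound]; integrating along rays gives [log_growth].

    Laplacians are read off second-order expansions ([jet]), which are stable under composition
    ([jet_comp]) and obey a maximum principle ([jet_max]). The method is applied to f', so f' must
    itself be holomorphic ([cderiv_derivative]); this rests on Goursat's lemma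
    [contour_eq0_of_cderiv] and on [cauchy_formula].

    In several variables, restriction to complex lines lets a bound spread from a point to a
    polydisc whose size does not depend on f ([schottky_polydisc]). Connectedness carries the bound
    from [a] to every point of Omega ([uniformly_bounded_domain]), and compactness makes it uniform
    ([uniformly_bounded_compact]) on the closure of the set where delta >= eps, which stays inside
    Omega ([closure_inner_subset]). *)

Section Basics.
Context {R : realType}.
Implicit Types (z w h : R[i]) (x y : R).

Lemma N_ge0 z : 0 <= N z.
Proof. by case: z => a b; exact: sqrtr_ge0. Qed.

Lemma N_sqr z : N z ^+ 2 = Re z ^+ 2 + Im z ^+ 2.
Proof. by case: z => a b; rewrite sqr_sqrtr// addr_ge0// sqr_ge0. Qed.

Lemma N0 : N (0 : R[i]) = 0. Proof. exact: ComplexField.Normc.normc0. Qed.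
Lemma N1 : N (1 : R[i]) = 1. Proof. exact: ComplexField.Normc.normc1. Qed.

Lemma NM z w : N (z * w) = N z * N w.
Proof. exact: ComplexField.Normc.normcM. Qed.

Lemma NV z : N z^-1 = (N z)^-1.
Proof. exact: ComplexField.Normc.normcV. Qed.

Lemma NX z n : N (z ^+ n) = N z ^+ n.
Proof. by elim: n => [|n IH]; rewrite ?expr0 ?N1// !exprS NM IH. Qed.

Lemma ND z w : N (z + w) <= N z + N w.
Proof. exact: le_normcD. Qed.

Lemma NN z : N (- z) = N z.
Proof. exact: normcN. Qed.

Lemma NBC z w : N (z - w) = N (w - z).
Proof. by rewrite -NN opprB. Qed.

Lemma NB z w : N (z - w) <= N z + N w.
Proof. by rewrite -(NN w) ND. Qed.

Lemma NR x : N x%:C = `|x|.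
Proof. by rewrite /= expr0n addr0 sqrtr_sqr. Qed.

Lemma N_natr n : N (n%:R : R[i]) = n%:R.
Proof. by rewrite -(rmorph_nat (real_complex R)) NR normr_nat. Qed.

Lemma N_eq0 z : (N z == 0) = (z == 0).
Proof.
apply/eqP/eqP => [|->]; last exact: N0.
exact: ComplexField.Normc.eq0_normc.
Qed.

Lemma N_gt0 z : (0 < N z) = (z != 0).
Proof. by rewrite lt_def N_ge0 andbT N_eq0. Qed.

Lemma normE z : `|z| = (N z)%:C.
Proof. by case: z. Qed.

Lemma Re_le_N z : `|Re z| <= N z.
Proof.
rewrite -ler_sqr ?nnegrE ?normr_ge0 ?N_ge0// N_sqr -normrX ger0_norm ?sqr_ge0//.
by rewrite lerDl sqr_ge0.
Qed.

Lemma Im_le_N z : `|Im z| <= N z.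
Proof.
rewrite -ler_sqr ?nnegrE ?normr_ge0 ?N_ge0// N_sqr -normrX ger0_norm ?sqr_ge0//.
by rewrite lerDr sqr_ge0.
Qed.

Lemma N_le_ReIm z : N z <= `|Re z| + `|Im z|.
Proof.
rewrite -ler_sqr ?nnegrE ?addr_ge0 ?N_ge0// N_sqr.
have -> : Re z ^+ 2 = `|Re z| ^+ 2 by rewrite -normrX ger0_norm ?sqr_ge0.
have -> : Im z ^+ 2 = `|Im z| ^+ 2 by rewrite -normrX ger0_norm ?sqr_ge0.
have := normr_ge0 (Re z); have := normr_ge0 (Im z); nra.
Qed.

Lemma cReD z w : Re (z + w) = Re z + Re w. Proof. by case: z w => ? ? []. Qed.
Lemma cImD z w : Im (z + w) = Im z + Im w. Proof. by case: z w => ? ? []. Qed.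
Lemma cReN z : Re (- z) = - Re z. Proof. by case: z. Qed.
Lemma cImN z : Im (- z) = - Im z. Proof. by case: z. Qed.
Lemma cReM z w : Re (z * w) = Re z * Re w - Im z * Im w.
Proof. by case: z w => ? ? []. Qed.
Lemma cImM z w : Im (z * w) = Re z * Im w + Im z * Re w.
Proof. by case: z w => ? ? []. Qed.

Definition ReImE := (cReD, cImD, cReN, cImN, cReM, cImM).

Lemma C_eqP z w : Re z = Re w -> Im z = Im w -> z = w.
Proof. by case: z w => ? ? [? ?] /= -> ->. Qed.

End Basics.

Section RealDeriv.
Context {R : realType}.
Implicit Types (f g : R -> R) (x y : R).

(* [rderiv], like [pderiv] and [cderiv] below, is the epsilon-delta form of   *)
(* differentiability: it makes restriction to lines and composition across    *)
(* R and R[i] elementary.                                                     *)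
Definition rderiv f x d := forall e, 0 < e -> exists2 r, 0 < r &
  forall h, `|h| < r -> `|f (x + h) - f x - d * h| <= e * `|h|.

Lemma rderivP f x d : rderiv f x d <-> is_derive x 1 f d.
Proof.
split=> [fd|[df dfE] e e0].
  have H : h^-1 *: ((f \o shift x) (h *: 1) - f x) @[h --> 0^'] --> d.
    apply/cvgrPdist_le => /= e /fd[r r0 H].
    near=> h.
    have h0 : h != 0 by near: h; exact: nbhs_dnbhs_neq.
    have hr : `|h| < r by near: h; apply: dnbhs0_lt.
    rewrite [h *: 1]mulr1 [h + x]addrC distrC.
    have -> : h^-1 *: (f (x + h) - f x) - d = h^-1 * (f (x + h) - f x - d * h).
      by rewrite /GRing.scale /=; field.
    by rewrite normrM normfV mulrC ler_pdivrMr ?normr_gt0// H.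
  have df : derivable f x 1 by apply/cvg_ex; exists d.
  by apply: (DeriveDef df); apply: cvg_lim H; exact: Rhausdorff.
have /cvgrPdist_le /(_ e e0) : h^-1 *: ((f \o shift x) (h *: 1) - f x) @[h --> 0^'] --> d.
  by rewrite -dfE.
move=> -[r /= r0 H].
exists r => // h hr.
have [->|h0] := eqVneq h 0; first by rewrite addr0 mulr0 subr0 subrr !normr0 mulr0.
have := H h; rewrite /ball_ /= sub0r normrN => /(_ hr h0).
rewrite [h *: 1]mulr1 [h + x]addrC distrC.
have -> : h^-1 *: (f (x + h) - f x) - d = h^-1 * (f (x + h) - f x - d * h).
  by rewrite /GRing.scale /=; field.
by rewrite normrM normfV mulrC ler_pdivrMr ?normr_gt0.
Unshelve. all: by end_near. Qed.

Lemma rderiv_continuous f x d : rderiv f x d -> {for x, continuous f}.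
Proof.
move=> /rderivP [fd _]; apply: differentiable_continuous.
exact/derivable1_diffP.
Qed.

Lemma rderiv_MVT f df a b : a <= b ->
  (forall x, a <= x <= b -> rderiv f x (df x)) ->
  exists2 c, a <= c <= b & f b - f a = df c * (b - a).
Proof.
move=> ab fd; have [||c cab ->] := @MVT_segment R f df a b ab.
- by move=> x /[!in_itv]/= /andP[ax xb]; apply/rderivP/fd; rewrite !ltW.
- apply: continuous_in_subspaceT => t; rewrite inE/= in_itv/= => tab.
  exact: rderiv_continuous (fd t tab).
by move: cab; rewrite in_itv/=; exists c.
Qed.

End RealDeriv.

(** * Integrals of continuous functions *)

Section RealIntegral.
Context {R : realType}.
Implicit Types (f g : R -> R) (x y a b : R).

Lemma rderivD f g x df dg :
  rderiv f x df -> rderiv g x dg -> rderiv (fun x => f x + g x) x (df + dg).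
Proof. by move=> /rderivP fd /rderivP gd; apply/rderivP; exact: is_deriveD. Qed.

Lemma rderivZ f c x df : rderiv f x df -> rderiv (fun x => c * f x) x (c * df).
Proof. by move=> /rderivP fd; apply/rderivP; exact: is_deriveZ. Qed.

Lemma rderivB f g x df dg :
  rderiv f x df -> rderiv g x dg -> rderiv (fun x => f x - g x) x (df - dg).
Proof. by move=> /rderivP fd /rderivP gd; apply/rderivP; exact: is_deriveB. Qed.

Lemma rderiv_const c x : rderiv (fun=> c) x 0.
Proof. by apply/rderivP; exact: is_derive_cst. Qed.

Lemma rderivM (f g : R -> R) x df dg :
  rderiv f x df -> rderiv g x dg -> rderiv (fun x => f x * g x) x (f x * dg + g x * df).
Proof. by move=> /rderivP fd /rderivP gd; apply/rderivP; exact: is_deriveM. Qed.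

Lemma rderivV (f : R -> R) x d : f x != 0 -> rderiv f x d ->
  rderiv (fun y => (f y)^-1) x (- (f x ^+ 2)^-1 * d).
Proof.
move=> fx /rderivP[fd <-]; apply/rderivP.
by apply: (DeriveDef (derivableV fx fd)); rewrite deriveV.
Qed.

Lemma rderiv_id (x : R) : rderiv id x 1.
Proof. by apply/rderivP; exact: is_derive_id. Qed.

Lemma rderiv_comp (f g : R -> R) x df dg :
  rderiv f (g x) df -> rderiv g x dg -> rderiv (fun y => f (g y)) x (df * dg).
Proof.
by move=> /rderivP fd /rderivP gd; apply/rderivP; exact: (@is_derive1_comp _ f g x df dg fd gd).
Qed.

Lemma rderiv_near f g x d r : 0 < r ->
  (forall y, `|y - x| < r -> f y = g y) -> rderiv f x d -> rderiv g x d.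
Proof.
move=> r0 fg fd e /fd[s s0 H]; exists (Num.min r s); first by rewrite lt_min r0.
move=> h; rewrite lt_min => /andP[hr hs].
rewrite -!fg ?H// ?subrr ?normr0// addrAC subrr add0r//.
Qed.

Lemma rderiv_eq0 f a b : (forall x, Num.min a b <= x <= Num.max a b -> rderiv f x 0) ->
  f a = f b.
Proof.
wlog ab : a b / a <= b => [H|] fd.
  by have [/H->|/ltW/H->//] := leP a b; rewrite // minC maxC.
move: fd; rewrite (min_idPl ab) (max_idPr ab) => fd.
have [c _ /eqP] := rderiv_MVT ab fd.
by rewrite mul0r subr_eq0 => /eqP.
Qed.

Lemma antiderivative_right g a x : continuous g -> a < x ->
  rderiv (fun y => (\int[@lebesgue_measure R]_(t in [set` `[a, y]]) g t)%R) x (g x).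
Proof.
move=> cg ax; apply/rderivP.
have xx1 : x < x + 1 by rewrite ltrDl.
have gi : (@lebesgue_measure R).-integrable `[a, x + 1] (EFin \o g).
  apply: continuous_compact_integrable; first exact: segment_compact.
  exact: continuous_subspaceT.
have [d1 d2] := continuous_FTC1_closed xx1 gi ax (cg x).
by rewrite derive1E in d2; exact: (DeriveDef d1 d2).
Qed.

(** The fundamental theorem of calculus differentiates an integral only to the right of its base
    point, so the base point moves with [x]. By [FE] this is harmless once values are normalised at
    0. *)
Lemma antiderivative g : continuous g -> exists G, forall x, rderiv G x (g x).
Proof.
move=> cg.
pose F a y := (\int[@lebesgue_measure R]_(t in [set` `[a, y]]) g t)%R.
have FE a b x y : a < x -> a < y -> b < x -> b < y -> F a x - F b x = F a y - F b y.
  move=> ax ay bx by_; apply: (@rderiv_eq0 (fun t => F a t - F b t)) => t.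
  rewrite ge_min le_max => /andP[t1 t2].
  have [a1 b1] : a < t /\ b < t.
    by case/orP: t1 => t1; split; apply: lt_le_trans t1.
  rewrite -(subrr (g t)).
  by apply: rderivB; exact: antiderivative_right.
exists (fun x => F (Num.min x 0 - 1) x - F (Num.min x 0 - 1) 0) => x.
pose A := Num.min x 0 - 2.
have Ax : A < x by rewrite /A; case: (leP x 0); lra.
have A0 : A < 0 by rewrite /A; case: (leP x 0); lra.
apply: (@rderiv_near (fun y => F A y - F A 0) _ _ _ 1) => //.
  move=> y; rewrite ltr_norml => /andP[y1 y2].
  have Ay : A < y by rewrite /A; case: (leP x 0); lra.
  have By : Num.min y 0 - 1 < y by case: (leP y 0); lra.
  have B0 : Num.min y 0 - 1 < 0 by case: (leP y 0); lra.
  by have := FE _ _ _ _ Ay A0 By B0; lra.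
rewrite -[g x]subr0; apply: rderivB; first exact: antiderivative_right.
exact: rderiv_const.
Qed.

(* Integrals of continuous functions are differences of a chosen primitive. *)
Definition prim g : R -> R :=
  xget (fun=> 0) [set G | forall x, rderiv G x (g x)].

Definition rint g a b := prim g b - prim g a.

Lemma rderiv_prim g x : continuous g -> rderiv (prim g) x (g x).
Proof. by move=> /antiderivative/(@xgetPex _ (fun=> 0))/(_ x). Qed.

Lemma rint_FTC G g a b : continuous g -> a <= b ->
  (forall x, a <= x <= b -> rderiv G x (g x)) -> rint g a b = G b - G a.
Proof.
move=> cg ab Gg; rewrite /rint.
suff : prim g a - G a = prim g b - G b by lra.
apply: (@rderiv_eq0 (fun t => prim g t - G t)).
rewrite (min_idPl ab) (max_idPr ab) => x xab.
by rewrite -(subrr (g x)); apply: rderivB; [exact: rderiv_prim | exact: Gg].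
Qed.

Lemma rint_le g a b e : continuous g -> a <= b ->
  (forall x, a <= x <= b -> `|g x| <= e) -> `|rint g a b| <= e * (b - a).
Proof.
move=> cg ab ge; rewrite /rint.
have [c cab ->] := rderiv_MVT ab (fun x _ => @rderiv_prim g x cg).
by rewrite normrM (ger0_norm (_ : 0 <= b - a)) ?subr_ge0// ler_wpM2r ?subr_ge0// ge.
Qed.

Lemma rint_gt0 g a b : continuous g -> a < b ->
  (forall x, a <= x <= b -> 0 < g x) -> 0 < rint g a b.
Proof.
move=> cg ab ge; rewrite /rint.
have [c cab ->] := rderiv_MVT (ltW ab) (fun x _ => @rderiv_prim g x cg).
by rewrite mulr_gt0 ?ge// subr_gt0.
Qed.

Lemma rint_chasles g a b c : rint g a b + rint g b c = rint g a c.
Proof. by rewrite /rint; ring. Qed.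

Lemma rintD f g a b : continuous f -> continuous g -> a <= b ->
  rint (fun x => f x + g x) a b = rint f a b + rint g a b.
Proof.
move=> cf cg ab.
rewrite (@rint_FTC (fun x => prim f x + prim g x))//.
- by rewrite /rint; ring.
- by move=> x; apply: cvgD; [exact: cf | exact: cg].
- by move=> x _; apply: rderivD; exact: rderiv_prim.
Qed.

Lemma rintZ g c a b : continuous g -> a <= b ->
  rint (fun x => c * g x) a b = c * rint g a b.
Proof.
move=> cg ab.
rewrite (@rint_FTC (fun x => c * prim g x))//.
- by rewrite /rint; ring.
- by move=> x; apply: cvgMr; exact: cg.
- by move=> x _; apply: rderivZ; exact: rderiv_prim.
Qed.

End RealIntegral.

(** * Integrals of complex functions of a real variable *)

Section PathIntegral.
Context {R : realType}.
Implicit Types (g : R -> R[i]) (t a b : R).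

Definition pcont g := continuous (fun t => Re (g t)) /\ continuous (fun t => Im (g t)).

Definition pderiv g t d := forall e, 0 < e -> exists2 r, 0 < r &
  forall h : R, `|h| < r -> N (g (t + h) - g t - d * h%:C) <= e * `|h|.

Definition cint g a b : R[i] :=
  rint (fun t => Re (g t)) a b +i* rint (fun t => Im (g t)) a b.

Lemma pderiv_Re g t d : pderiv g t d -> rderiv (fun t => Re (g t)) t (Re d).
Proof.
move=> gd e /gd[r r0 H]; exists r => // h /H; apply: le_trans.
apply: le_trans (Re_le_N _); rewrite le_eqVlt; apply/orP; left; apply/eqP.
by congr `| _ |; rewrite !ReImE /=; ring.
Qed.

Lemma pderiv_Im g t d : pderiv g t d -> rderiv (fun t => Im (g t)) t (Im d).
Proof.
move=> gd e /gd[r r0 H]; exists r => // h /H; apply: le_trans.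
apply: le_trans (Im_le_N _); rewrite le_eqVlt; apply/orP; left; apply/eqP.
by congr `| _ |; rewrite !ReImE /=; ring.
Qed.

Lemma cint_FTC G g a b : pcont g -> a <= b ->
  (forall t, a <= t <= b -> pderiv G t (g t)) -> cint g a b = G b - G a.
Proof.
move=> [cr ci] ab Gg; rewrite /cint.
rewrite (@rint_FTC _ (fun t => Re (G t)))//; last by move=> t /Gg /pderiv_Re.
rewrite (@rint_FTC _ (fun t => Im (G t)))//; last by move=> t /Gg /pderiv_Im.
by apply: C_eqP; rewrite !ReImE.
Qed.

Lemma cint_chasles g a b c : cint g a b + cint g b c = cint g a c.
Proof. by rewrite /cint; simpc; rewrite !rint_chasles. Qed.

Lemma pcontZ c g : pcont g -> pcont (fun t => c * g t).
Proof.
move=> [gr gi]; split.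
  have -> : (fun t => Re (c * g t)) = fun t => Re c * Re (g t) - Im c * Im (g t).
    by apply/funext => t; rewrite cReM.
  by move=> x; apply: cvgB; apply: cvgMr; [exact: gr | exact: gi].
have -> : (fun t => Im (c * g t)) = fun t => Re c * Im (g t) + Im c * Re (g t).
    by apply/funext => t; rewrite cImM.
by move=> x; apply: cvgD; apply: cvgMr; [exact: gi | exact: gr].
Qed.

Lemma cintD f g a b : pcont f -> pcont g -> a <= b ->
  cint (fun t => f t + g t) a b = cint f a b + cint g a b.
Proof.
move=> [fr fi] [gr gi] ab; rewrite /cint; simpc.
rewrite -!rintD//; congr (rint _ _ _ +i* rint _ _ _); apply/funext => t; rewrite ?cReD ?cImD//.
Qed.

Lemma cintZ c g a b : pcont g -> a <= b ->
  cint (fun t => c * g t) a b = c * cint g a b.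
Proof.
move=> [gr gi] ab; case: c => x y; rewrite /cint; simpc.
have zr (z : R) (h : R -> R) : continuous h -> continuous (fun t : R => z * h t).
  by move=> ch t; apply: cvgMr; exact: ch.
rewrite -mulNr -!rintZ// -!rintD//; try exact: zr.
by congr (rint _ _ _ +i* rint _ _ _); apply/funext => t; rewrite ?cReM ?cImM//= mulNr.
Qed.

(** The factor 2 is the price of estimating real and imaginary parts separately. *)
Lemma cint_le g a b e : pcont g -> a <= b ->
  (forall t, a <= t <= b -> N (g t) <= e) -> N (cint g a b) <= 2 * e * (b - a).
Proof.
move=> [gr gi] ab ge; apply: le_trans (N_le_ReIm _) _.
rewrite -mulrA mulr2n mulrDl mul1r; apply: lerD; apply: rint_le => // t /ge.
  exact: le_trans (Re_le_N _).
exact: le_trans (Im_le_N _).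
Qed.

End PathIntegral.

(** * Complex derivatives *)

Section ComplexDeriv.
Context {R : realType}.
Implicit Types (f g : R[i] -> R[i]) (z w h d : R[i]).

Definition cderiv f z d := forall e, 0 < e -> exists2 r, 0 < r &
  forall h, N h < r -> N (f (z + h) - f z - d * h) <= e * N h.

Lemma cderivP f z d : cderiv f z d <-> is_derive z 1 f d.
Proof.
split=> [fd|[df dfE] e e0].
  have H : h^-1 *: ((f \o shift z) (h *: 1) - f z) @[h --> 0^'] --> d.
    apply/cvgrPdist_le => /= e.
    rewrite ltcE /= => /andP[/eqP eI /fd[r r0 H]].
    near=> h.
    have h0 : h != 0 by near: h; exact: nbhs_dnbhs_neq.
    have hr : N h < r.
      rewrite -ltcR -normE; near: h; apply: dnbhs0_lt; by rewrite ltcR.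
    rewrite [h *: 1]mulr1 [h + z]addrC distrC.
    have -> : h^-1 *: (f (z + h) - f z) - d = h^-1 * (f (z + h) - f z - d * h).
      by rewrite /GRing.scale /=; field.
    rewrite normE NM NV lecE /= eI eqxx /=.
    by rewrite mulrC ler_pdivrMr ?N_gt0// H.
  have df : derivable f z 1 by apply/cvg_ex; exists d.
  by apply: (DeriveDef df); apply: cvg_lim H; exact: norm_hausdorff.
have /cvgrPdist_le /(_ e%:C) : h^-1 *: ((f \o shift z) (h *: 1) - f z) @[h --> 0^'] --> d.
  by rewrite -dfE.
rewrite ltcR => /(_ e0) -[r /= r0 H].
move: r0; rewrite ltcE /= => /andP[/eqP rI r0].
exists (Re r) => // h hr.
have [->|h0] := eqVneq h 0; first by rewrite addr0 mulr0 subr0 subrr !N0 mulr0.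
have := H h; rewrite /ball_ /= sub0r normrN normE ltcE /= rI eqxx /= => /(_ hr h0).
rewrite [h *: 1]mulr1 [h + z]addrC distrC.
have -> : h^-1 *: (f (z + h) - f z) - d = h^-1 * (f (z + h) - f z - d * h).
  by rewrite /GRing.scale /=; field.
by rewrite normE NM NV lecR mulrC ler_pdivrMr ?N_gt0.
Unshelve. all: by end_near. Qed.

Lemma cderivD f g z df dg :
  cderiv f z df -> cderiv g z dg -> cderiv (fun x => f x + g x) z (df + dg).
Proof. by move=> /cderivP fd /cderivP gd; apply/cderivP; exact: is_deriveD. Qed.

Lemma cderivB f g z df dg :
  cderiv f z df -> cderiv g z dg -> cderiv (fun x => f x - g x) z (df - dg).
Proof. by move=> /cderivP fd /cderivP gd; apply/cderivP; exact: is_deriveB. Qed.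

Lemma cderivM f g z df dg : cderiv f z df -> cderiv g z dg ->
  cderiv (fun x => f x * g x) z (f z * dg + g z * df).
Proof. by move=> /cderivP fd /cderivP gd; apply/cderivP; exact: is_deriveM. Qed.

Lemma cderivV f z df : f z != 0 -> cderiv f z df ->
  cderiv (fun x => (f x)^-1) z (- (f z ^+ 2)^-1 * df).
Proof.
move=> fz /cderivP[fd <-]; apply/cderivP.
by apply: (DeriveDef (derivableV fz fd)); rewrite deriveV.
Qed.

Lemma cderiv_const c z : cderiv (fun=> c) z 0.
Proof. by apply/cderivP; exact: is_derive_cst. Qed.

Lemma cderiv_id z : cderiv id z 1.
Proof. by apply/cderivP; exact: is_derive_id. Qed.

Lemma cderiv_eq f z d d' : d = d' -> cderiv f z d -> cderiv f z d'.
Proof. by move=> ->. Qed.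

Lemma cderiv_near f g z d r : 0 < r ->
  (forall w, N (w - z) < r -> f w = g w) -> cderiv f z d -> cderiv g z d.
Proof.
move=> r0 fg fd e /fd[s s0 H]; exists (Num.min r s); first by rewrite lt_min r0.
move=> h; rewrite lt_min => /andP[hr hs].
rewrite -!fg ?H// ?subrr ?N0// addrAC subrr add0r//.
Qed.

Lemma cderiv_affine f z c d u : cderiv f (c + u * z) d ->
  cderiv (fun w => f (c + u * w)) z (d * u).
Proof.
move=> fd e e0.
(* The 1 keeps the divisor positive when [u] is 0. *)
have u0 : 0 < 1 + N u by rewrite ltr_pwDl ?N_ge0.
have /fd[r r0 H] : 0 < e / (1 + N u) by rewrite divr_gt0.
exists (r / (1 + N u)); first by rewrite divr_gt0.
move=> h; rewrite ltr_pdivlMr// => hr.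
have uh : N (u * h) <= N h * (1 + N u).
  by rewrite NM mulrC ler_wpM2l ?N_ge0// lerDr.
rewrite mulrDr addrA -mulrA; apply: le_trans (H _ _) _; first exact: le_lt_trans hr.
apply: le_trans (ler_wpM2l _ uh) _; first by rewrite ltW// divr_gt0.
by rewrite mulrCA divfK ?gt_eqF// mulrC.
Qed.

(** Tolerances in the topology of R[i] are positive elements of R[i], hence real; this reduces
    convergence to estimates of [N] over R. *)
Lemma cvg_N (T : Type) (F : set_system T) {FF : Filter F} (f : T -> R[i]) z :
  (forall e, 0 < e -> \forall x \near F, N (f x - z) <= e) -> f @ F --> z.
Proof.
move=> H; apply/cvgrPdist_le => e; rewrite ltcE /= => /andP[/eqP eI /H].
apply: filterS => x; rewrite normE lecE /= eI eqxx /=.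
by rewrite NBC.
Qed.

Lemma cvg_NP (T : Type) (F : set_system T) {FF : Filter F} (f : T -> R[i]) z :
  f @ F --> z -> forall e, 0 < e -> \forall x \near F, N (f x - z) <= e.
Proof.
move=> /cvgrPdist_le H e e0; have := H e%:C; rewrite ltcR => /(_ e0).
by apply: filterS => x; rewrite normE lecR NBC.
Qed.

Lemma cvg_Complex (T : Type) (F : set_system T) {FF : Filter F} (u v : T -> R) x y :
  u @ F --> x -> v @ F --> y -> (fun t => u t +i* v t) @ F --> x +i* y.
Proof.
move=> ux vy; apply: cvg_N => e e0.
have e2 : 0 < e / 2 by rewrite divr_gt0.
move/cvgrPdist_le : ux => /(_ _ e2); move/cvgrPdist_le : vy => /(_ _ e2).
apply: filterS2 => t; rewrite distrC => H1; rewrite distrC => H2.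
by apply: le_trans (N_le_ReIm _) _ => /=; lra.
Qed.

Lemma nbhs_N z (A : set R[i]) :
  nbhs z A <-> exists2 r, 0 < r & forall w, N (w - z) < r -> A w.
Proof.
split=> [/nbhs_ballP[r /= r0 H]|[r r0 H]].
  move: r0; rewrite ltcE /= => /andP[/eqP rI r0]; exists (Re r) => // w wr.
  by apply: H; rewrite /ball /= normE NBC ltcE /= rI eqxx.
apply/nbhs_ballP; exists r%:C => /=; first by rewrite ltcR.
by move=> w; rewrite /ball /= normE NBC ltcR => /H.
Qed.

Lemma continuous_Re : continuous (@Re R).
Proof.
move=> z; apply/(@cvgrPdist_le _ _ _ (nbhs z) (nbhs_filter z)) => e e0.
by apply/nbhs_N; exists e => // w /ltW /=; apply: le_trans; rewrite distrC -cReN -cReD Re_le_N.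
Qed.

Lemma continuous_Im : continuous (@Im R).
Proof.
move=> z; apply/(@cvgrPdist_le _ _ _ (nbhs z) (nbhs_filter z)) => e e0.
by apply/nbhs_N; exists e => // w /ltW /=; apply: le_trans; rewrite distrC -cImN -cImD Im_le_N.
Qed.

Lemma cderiv_continuous f z d : cderiv f z d -> {for z, continuous f}.
Proof.
move=> /cderivP[fd _]; apply: differentiable_continuous.
exact/derivable1_diffP.
Qed.

Lemma pderiv_horizontal f x y d : cderiv f (x +i* y) d ->
  pderiv (fun t => f (t +i* y)) x d.
Proof.
move=> fd e /fd[r r0 H]; exists r => // h hr.
have -> : (x + h) +i* y = x +i* y + h%:C by apply: C_eqP; rewrite /= ?addr0.
by rewrite -NR; apply: H; rewrite NR.
Qed.

Lemma pderiv_vertical f x y d : cderiv f (x +i* y) d ->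
  pderiv (fun t => f (x +i* t)) y ('i * d).
Proof.
move=> fd e /fd[r r0 H]; exists r => // h hr.
have -> : x +i* (y + h) = x +i* y + 'i * h%:C by apply: C_eqP; rewrite /=; ring.
have Ni : N ('i * h%:C : R[i]) = `|h|.
  by rewrite NM NR /= expr0n expr1n add0r sqrtr1 mul1r.
have -> : 'i * d * h%:C = d * ('i * h%:C) by ring.
by rewrite -Ni; apply: H; rewrite Ni.
Qed.

Lemma pcont_horizontal f y : (forall x, {for x +i* y, continuous f}) ->
  pcont (fun t => f (t +i* y)).
Proof.
move=> cf; have H t : (fun s => f (s +i* y)) s @[s --> t] --> f (t +i* y).
  apply: (@cvg_comp _ _ _ (fun s => s +i* y) f); last exact: cf.
  by apply: cvg_Complex; [exact: cvg_id | exact: cvg_cst].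
split=> t; apply: (cvg_comp _ _ (H t)); [exact: continuous_Re | exact: continuous_Im].
Qed.

Lemma pcont_vertical f x : (forall y, {for x +i* y, continuous f}) ->
  pcont (fun t => f (x +i* t)).
Proof.
move=> cf; have H t : (fun s => f (x +i* s)) s @[s --> t] --> f (x +i* t).
  apply: (@cvg_comp _ _ _ (fun s => x +i* s) f); last exact: cf.
  by apply: cvg_Complex; [exact: cvg_cst | exact: cvg_id].
split=> t; apply: (cvg_comp _ _ (H t)); [exact: continuous_Re | exact: continuous_Im].
Qed.

End ComplexDeriv.

(** * Goursat's lemma on rectangles *)

Section Contour.
Context {R : realType}.
Implicit Types (f g : R[i] -> R[i]) (z w : R[i]) (a b c d : R).

(** The counterclockwise boundary integral; the factor ['i] is dz / dy on the vertical sides. *)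
Definition contour f a b c d : R[i] :=
  cint (fun x => f (x +i* c)) a b + 'i * cint (fun y => f (b +i* y)) c d
  - cint (fun x => f (x +i* d)) a b - 'i * cint (fun y => f (a +i* y)) c d.

(** Whole lines, not just the four segments: [cint] is defined through primitives on all of R, so
    integrands must be continuous, and are compared, along entire lines. *)
Definition sidelines a b c d z := [\/ Re z = a, Re z = b, Im z = c | Im z = d].

Definition rect a b c d z := a <= Re z <= b /\ c <= Im z <= d.

Lemma contour_split_Re f a m b c d :
  contour f a b c d = contour f a m c d + contour f m b c d.
Proof. by rewrite /contour -!(cint_chasles _ a m b); ring. Qed.

Lemma contour_split_Im f a b c m d :
  contour f a b c d = contour f a b c m + contour f a b m d.
Proof. by rewrite /contour -!(cint_chasles _ c m d); ring. Qed.

Lemma eq_contour f g a b c d :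
  (forall z, sidelines a b c d z -> f z = g z) ->
  contour f a b c d = contour g a b c d.
Proof.
move=> fg; rewrite /contour; congr (_ + 'i * _ - _ - 'i * _).
- by congr cint; apply/funext => t; apply: fg; constructor 3.
- by congr cint; apply/funext => t; apply: fg; constructor 2.
- by congr cint; apply/funext => t; apply: fg; constructor 4.
- by congr cint; apply/funext => t; apply: fg; constructor 1.
Qed.

Definition contour_cont f a b c d :=
  forall z, sidelines a b c d z -> {for z, continuous f}.

Section Sides.
Variables (f : R[i] -> R[i]) (a b c d : R).
Hypothesis cf : contour_cont f a b c d.

Lemma contour_cont_bottom : pcont (fun x => f (x +i* c)).
Proof. by apply: pcont_horizontal => x; apply: cf; constructor 3. Qed.

Lemma contour_cont_top : pcont (fun x => f (x +i* d)).
Proof. by apply: pcont_horizontal => x; apply: cf; constructor 4. Qed.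

Lemma contour_cont_left : pcont (fun y => f (a +i* y)).
Proof. by apply: pcont_vertical => x; apply: cf; constructor 1. Qed.

Lemma contour_cont_right : pcont (fun y => f (b +i* y)).
Proof. by apply: pcont_vertical => x; apply: cf; constructor 2. Qed.

End Sides.

Lemma contourD f g a b c d : a <= b -> c <= d ->
  contour_cont f a b c d -> contour_cont g a b c d ->
  contour (fun z => f z + g z) a b c d = contour f a b c d + contour g a b c d.
Proof.
move=> ab cd cf cg; rewrite /contour.
rewrite (cintD (contour_cont_bottom cf) (contour_cont_bottom cg))//.
rewrite (cintD (contour_cont_top cf) (contour_cont_top cg))//.
rewrite (cintD (contour_cont_left cf) (contour_cont_left cg))//.
by rewrite (cintD (contour_cont_right cf) (contour_cont_right cg))//; ring.
Qed.

Lemma contourZ k f a b c d : a <= b -> c <= d -> contour_cont f a b c d ->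
  contour (fun z => k * f z) a b c d = k * contour f a b c d.
Proof.
move=> ab cd cf; rewrite /contour.
rewrite (cintZ k (contour_cont_bottom cf))// (cintZ k (contour_cont_top cf))//.
rewrite (cintZ k (contour_cont_left cf))// (cintZ k (contour_cont_right cf))//.
by ring.
Qed.

Lemma contour_le f a b c d e : a <= b -> c <= d -> contour_cont f a b c d ->
  (forall z, rect a b c d z -> sidelines a b c d z -> N (f z) <= e) ->
  N (contour f a b c d) <= 4 * e * ((b - a) + (d - c)).
Proof.
move=> ab cd cf fe; rewrite /contour.
have Ni : N ('i : R[i]) = 1 by rewrite /= expr0n expr1n add0r sqrtr1.
have H1 : N (cint (fun x => f (x +i* c)) a b) <= 2 * e * (b - a).
  apply: cint_le => //; first exact: contour_cont_bottom cf.
  by move=> t tab; apply: fe; [split=> //=; rewrite lexx | constructor 3].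
have H2 : N (cint (fun x => f (x +i* d)) a b) <= 2 * e * (b - a).
  apply: cint_le => //; first exact: contour_cont_top cf.
  by move=> t tab; apply: fe; [split=> //=; rewrite lexx andbT | constructor 4].
have H3 : N (cint (fun y => f (a +i* y)) c d) <= 2 * e * (d - c).
  apply: cint_le => //; first exact: contour_cont_left cf.
  by move=> t tab; apply: fe; [split=> //=; rewrite lexx | constructor 1].
have H4 : N (cint (fun y => f (b +i* y)) c d) <= 2 * e * (d - c).
  apply: cint_le => //; first exact: contour_cont_right cf.
  by move=> t tab; apply: fe; [split=> //=; rewrite lexx andbT | constructor 2].
apply: le_trans (NB _ _) _; rewrite NM Ni mul1r.
apply: le_trans (lerD (le_trans (NB _ _) (lerD (ND _ _) (lexx _))) (lexx _)) _.
by rewrite NM Ni mul1r; lra.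
Qed.

(** Each side contributes a difference of values of [F] at two corners, and these cancel around the
    rectangle. *)
Lemma contour_primitive F f a b c d : a <= b -> c <= d ->
  contour_cont f a b c d -> (forall z, sidelines a b c d z -> cderiv F z (f z)) ->
  contour f a b c d = 0.
Proof.
move=> ab cd cf Ff; rewrite /contour.
rewrite -!cintZ//; [|exact: contour_cont_left cf|exact: contour_cont_right cf].
rewrite (@cint_FTC _ (fun x => F (x +i* c)) (fun x => f (x +i* c))); last 3 first.
- exact: contour_cont_bottom cf.
- exact: ab.
- by move=> t _; apply: pderiv_horizontal; apply: Ff; constructor 3.
rewrite (@cint_FTC _ (fun x => F (x +i* d)) (fun x => f (x +i* d))); last 3 first.
- exact: contour_cont_top cf.
- exact: ab.
- by move=> t _; apply: pderiv_horizontal; apply: Ff; constructor 4.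
rewrite (@cint_FTC _ (fun y => F (b +i* y)) (fun y => 'i * f (b +i* y))); last 3 first.
- by apply: pcontZ; exact: contour_cont_right cf.
- exact: cd.
- by move=> t _; apply: pderiv_vertical; apply: Ff; constructor 2.
rewrite (@cint_FTC _ (fun y => F (a +i* y)) (fun y => 'i * f (a +i* y))); last 3 first.
- by apply: pcontZ; exact: contour_cont_left cf.
- exact: cd.
- by move=> t _; apply: pderiv_vertical; apply: Ff; constructor 1.
by ring.
Qed.

Lemma continuous_affine u v : continuous (fun z => u + v * z).
Proof.
move=> z; apply: (@cderiv_continuous _ _ _ (0 + (v * 1 + z * 0))).
apply: cderivD; first exact: cderiv_const.
apply: cderivM; [exact: cderiv_const | exact: cderiv_id].
Qed.

Lemma contour_affine u v a b c d : a <= b -> c <= d ->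
  contour (fun z => u + v * z) a b c d = 0.
Proof.
move=> ab cd; apply: (@contour_primitive (fun z => u * z + (v / 2) * (z * z))) => //.
  by move=> z _; exact: continuous_affine.
move=> z _; apply: cderiv_eq; last first.
  apply: cderivD; apply: cderivM; try exact: cderiv_const; try exact: cderiv_id.
  apply: cderivM; exact: cderiv_id.
by rewrite /=; field.
Qed.

End Contour.

(** * Bisection of rectangles *)

Section Bisection.
Context {R : realType}.
Implicit Types (s : R * R * R * R).

Let quarter s' s := let: (a', b', c', d') := s' in let: (a, b, c, d) := s in
  [/\ a <= a', b' <= b, c <= c' & d' <= d] /\
  (b' - a' = (b - a) / 2 /\ d' - c' = (d - c) / 2).

(** [P] is any property that a rectangle inherits from its four quarters. A bad rectangle then has a
    bad quarter; iterating the choice gives nested bad rectangles, and [z] is a point common to all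
    of them. *)
Lemma rect_bisection (P : R -> R -> R -> R -> Prop) (a b c d : R) :
  a <= b -> c <= d ->
  (forall a b c d, a <= b -> c <= d ->
     let m := (a + b) / 2 in let n := (c + d) / 2 in
     P a m c n -> P m b c n -> P a m n d -> P m b n d -> P a b c d) ->
  ~ P a b c d ->
  exists2 z : R[i], rect a b c d z & forall k, exists a' b' c' d',
    [/\ ~ P a' b' c' d', rect a' b' c' d' z, 
      (forall w, rect a' b' c' d' w -> rect a b c d w) &
      b' - a' = (b - a) / 2 ^+ k /\ d' - c' = (d - c) / 2 ^+ k].
Proof.
move=> ab cd PP nP.
pose Q s := let: (a, b, c, d) := s in [/\ a <= b, c <= d & ~ P a b c d].
have step s : Q s -> exists s', Q s' /\ quarter s' s.
  case: s => [[[{}a {}b] {}c] {}d] [{}ab {}cd {}nP].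
  apply: contrapT => H; apply: nP; apply: PP => //; apply: contrapT => nP;
    apply: H.
  - exists (a, (a + b) / 2, c, (c + d) / 2); do !split => //=; lra.
  - exists ((a + b) / 2, b, c, (c + d) / 2); do !split => //=; lra.
  - exists (a, (a + b) / 2, (c + d) / 2, d); do !split => //=; lra.
  - exists ((a + b) / 2, b, (c + d) / 2, d); do !split => //=; lra.
pose next s := xget s [set s' | Q s' /\ quarter s' s].
have nextP s : Q s -> Q (next s) /\ quarter (next s) s.
  by move=> /step; exact: (@xgetPex _ s).
clearbody next.
pose S k := iter k next (a, b, c, d).
have QS k : Q (S k) by elim: k => //= k /nextP[].
pose A k := (S k).1.1.1; pose B k := (S k).1.1.2.
pose C k := (S k).1.2; pose D k := (S k).2.
have AB k : [/\ A k <= B k, C k <= D k & ~ P (A k) (B k) (C k) (D k)].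
  by move: (QS k); rewrite /A /B /C /D; case: (S k) => [[[]]].
have ABS k : [/\ A k <= A k.+1, B k.+1 <= B k, C k <= C k.+1 & D k.+1 <= D k] /\
    (B k.+1 - A k.+1 = (B k - A k) / 2 /\ D k.+1 - C k.+1 = (D k - C k) / 2).
  have [_] := nextP _ (QS k).
  rewrite /A /B /C /D -[S k.+1]/(next (S k)) /quarter.
  by case: (next _) => [[[? ?] ?] ?]; case: (S k) => [[[? ?] ?] ?].
have mono j k : (j <= k)%N ->
    [/\ A j <= A k, B k <= B j, C j <= C k & D k <= D j].
  elim: k => [|k IH]; first by rewrite leqn0 => /eqP->.
  rewrite leq_eqVlt ltnS => /predU1P[->|/IH[? ? ? ?]]; first by split.
  by have [[? ? ? ?] _] := ABS k; split; lra.
have size k : B k - A k = (b - a) / 2 ^+ k /\ D k - C k = (d - c) / 2 ^+ k.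
  elim: k => [|k [IH1 IH2]]; first by rewrite expr0 !divr1.
  by have [_ [-> ->]] := ABS k; rewrite IH1 IH2 exprSr invfM !mulrA.
have cross j k : A j <= B k /\ C j <= D k.
  have [? ? ? ?] := mono _ _ (leq_maxl j k).
  have [? ? ? ?] := mono _ _ (leq_maxr j k).
  by have [? ? _] := AB (maxn j k); split; lra.
have hA : has_sup [set A k | k in setT].
  by split; [exists (A 0), 0 | exists (B 0) => _ [j _ <-]; have [] := cross j 0].
have hC : has_sup [set C k | k in setT].
  by split; [exists (C 0), 0 | exists (D 0) => _ [j _ <-]; have [] := cross j 0].
(* Left edges increase and never pass a right edge, so their supremum lies between the edges of
   every rectangle; likewise for lower edges. *)
pose z := sup [set A k | k in setT] +i* sup [set C k | k in setT].
have zin k : rect (A k) (B k) (C k) (D k) z.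
  split; apply/andP; split => /=.
  - by apply: ub_le_sup; [exact: hA.2 | exists k].
  - by apply: ge_sup; [exact: hA.1 | move=> _ [j _ <-]; have [] := cross j k].
  - by apply: ub_le_sup; [exact: hC.2 | exists k].
  - by apply: ge_sup; [exact: hC.1 | move=> _ [j _ <-]; have [] := cross j k].
exists z => [|k]; first exact: (zin 0).
exists (A k), (B k), (C k), (D k); split => //; first by have [] := AB k.
move=> w [/andP[? ?] /andP[? ?]].
have [? ? ? ?] := mono 0 k isT.
change (rect (A 0) (B 0) (C 0) (D 0) w).
by split; apply/andP; split; lra.
Qed.

End Bisection.

(** * Pointwise continuity of complex functions *)

Section ComplexContinuity.
Context {R : realType}.
Implicit Types (f g : R[i] -> R[i]) (z w : R[i]).

Lemma ccontP f z : {for z, continuous f} <-> forall e, 0 < e ->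
  exists2 r, 0 < r & forall w, N (w - z) < r -> N (f w - f z) <= e.
Proof.
split=> [cf e e0|H].
  by have /nbhs_N := @cvg_NP _ _ (nbhs z) (nbhs_filter z) f (f z) cf e e0.
by apply: (@cvg_N _ _ (nbhs z) (nbhs_filter z)) => e /H /nbhs_N.
Qed.

Lemma ccont_cst c z : {for z, continuous (fun _ : R[i] => c : R[i])}.
Proof. by apply/ccontP => e e0; exists 1 => // w _; rewrite subrr N0 ltW. Qed.

Lemma ccont_id z : {for z, continuous (fun w : R[i] => w)}.
Proof. by apply/ccontP => e e0; exists e => // w /ltW. Qed.

Lemma ccontD f g z : {for z, continuous f} -> {for z, continuous g} ->
  {for z, continuous (fun w => f w + g w)}.
Proof. by move=> cf cg; exact: (cvgD cf cg). Qed.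

Lemma ccontB f g z : {for z, continuous f} -> {for z, continuous g} ->
  {for z, continuous (fun w => f w - g w)}.
Proof. by move=> cf cg; exact: (cvgB cf cg). Qed.

Lemma ccontM f g z : {for z, continuous f} -> {for z, continuous g} ->
  {for z, continuous (fun w => f w * g w)}.
Proof. by move=> cf cg; exact: (cvgM cf cg). Qed.

Lemma ccontV f z : f z != 0 -> {for z, continuous f} ->
  {for z, continuous (fun w => (f w)^-1)}.
Proof. by move=> fz cf; exact: (cvgV fz cf). Qed.

Lemma ccont_comp f g z : {for z, continuous f} -> {for f z, continuous g} ->
  {for z, continuous (fun w => g (f w))}.
Proof.
move=> /ccontP cf /ccontP cg; apply/ccontP => e /cg[r r0 Hr].
have /cf[s s0 Hs] : 0 < r / 2 by rewrite divr_gt0.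
by exists s => // w /Hs H; apply: Hr; lra.
Qed.

Lemma ccont_near f g z r : 0 < r -> (forall w, N (w - z) < r -> f w = g w) ->
  {for z, continuous f} -> {for z, continuous g}.
Proof.
move=> r0 fg /ccontP cf; apply/ccontP => e /cf[s s0 H].
exists (Num.min r s); first by rewrite lt_min r0.
by move=> w; rewrite lt_min => /andP[wr ws]; rewrite -!fg ?H// subrr N0.
Qed.

End ComplexContinuity.

(** * Vanishing of contour integrals *)

Section Goursat.
Context {R : realType}.
Implicit Types (f g : R[i] -> R[i]) (z w : R[i]) (a b c d : R).

Lemma exists_pow2_gt (x r : R) : 0 <= x -> 0 < r -> exists k, x / 2 ^+ k < r.
Proof.
move=> x0 r0; exists (Num.bound (x / r)).
rewrite ltr_pdivrMr ?exprn_gt0// mulrC -ltr_pdivrMr//.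
apply: lt_le_trans (archi_boundP _) _; first by rewrite divr_ge0// ltW.
by rewrite -natrX ler_nat ltnW// ltn_expl.
Qed.

(** Bisection is applied to the estimate |contour| <= e * area, which adds up over quarters. If it
    failed, it would fail on arbitrarily small rectangles around some [z]; there [f] is affine up to
    a small error, and affine functions have contour 0. *)
Lemma contour_eq0_of_cderiv f a b c d : a < b -> c < d -> continuous f ->
  (forall z, rect a b c d z -> exists D, cderiv f z D) ->
  contour f a b c d = 0.
Proof.
move=> ab cd cf fd.
have area0 : 0 < (b - a) * (d - c) by rewrite mulr_gt0// subr_gt0.
suff H e : 0 < e -> N (contour f a b c d) <= e * ((b - a) * (d - c)).
  apply/eqP; rewrite -N_eq0 eq_le N_ge0 andbT leNgt; apply/negP => N0'.
  move: area0 H; move: ((b - a) * (d - c)) => A area0 /(_ (N (contour f a b c d) / (2 * A))).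
  have e0 : 0 < N (contour f a b c d) / (2 * A) by rewrite divr_gt0// mulr_gt0.
  move=> /(_ e0).
  have -> : N (contour f a b c d) / (2 * A) * A = N (contour f a b c d) / 2.
    by field; rewrite gt_eqF.
  by lra.
move=> e0.
pose P a b c d := N (contour f a b c d) <= e * ((b - a) * (d - c)).
apply: contrapT => nP.
have [|z zin Hz] := @rect_bisection R P a b c d (ltW ab) (ltW cd) _ nP.
  move=> {ab cd area0 nP fd}a {}b {}c {}d ab cd m n; rewrite /P => H1 H2 H3 H4.
  rewrite (contour_split_Re f a m b c d).
  rewrite (contour_split_Im f a m c n d) (contour_split_Im f m b c n d).
  apply: le_trans (ND _ _) _.
  apply: le_trans (lerD (ND _ _) (ND _ _)) _.
  have -> : (b - a) * (d - c) = (m - a) * (n - c) + (b - m) * (n - c) +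
    ((m - a) * (d - n) + (b - m) * (d - n)) by ring.
  by rewrite !mulrDr; lra.
have [D fzD] := fd _ zin.
set p := (b - a) + (d - c).
have p0 : 0 < p by rewrite /p; lra.
(* With this tolerance [contour_le] returns exactly [e] times the area: after k halvings the
   half-perimeter is [p / 2 ^+ k], and so is the bound on the distance to [z]. *)
have e'0 : 0 < e * ((b - a) * (d - c)) / (4 * p ^+ 2).
  by rewrite divr_gt0 ?mulr_gt0 ?exprn_gt0 ?subr_gt0.
have [r r0 Hr] := fzD _ e'0.
have [k kr] := exists_pow2_gt (ltW p0) r0.
have [a' [b' [c' [d' [nP' zin' sub [wE hE]]]]]] := Hz k.
apply: nP'; rewrite /P.
have q0 : (0 : R) < 2 ^+ k by rewrite exprn_gt0.
have ab' : a' <= b' by rewrite -subr_ge0 wE divr_ge0 ?subr_ge0 ?ltW.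
have cd' : c' <= d' by rewrite -subr_ge0 hE divr_ge0 ?subr_ge0 ?ltW.
pose g w := f w + ((D * z - f z) + (- D) * w).
have cg : continuous g.
  by move=> w; apply: (ccontD (cf w)); exact: continuous_affine.
have -> : contour f a' b' c' d' = contour g a' b' c' d'.
  rewrite /g contourD//; last 2 first.
  - by move=> w _; exact: cf.
  - by move=> w _; exact: continuous_affine.
  by rewrite contour_affine// addr0.
have pE : (b' - a') + (d' - c') = p / 2 ^+ k.
  rewrite wE hE /p. by rewrite -mulrDl.
apply: (@le_trans _ _ (4 * (e * ((b - a) * (d - c)) / (4 * p ^+ 2) * (p / 2 ^+ k))
    * (p / 2 ^+ k))); last first.
  rewrite wE hE le_eqVlt; apply/orP; left; apply/eqP.
  by field; rewrite !gt_eqF.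
rewrite -pE; apply: contour_le => //; first by move=> w _; exact: cg.
move=> w [/andP[w1 w2] /andP[w3 w4]] _.
move: zin' => [/andP[z1 z2] /andP[z3 z4]].
have wz : N (w - z) <= (b' - a') + (d' - c').
  apply: le_trans (N_le_ReIm _) _; rewrite !ReImE.
  by apply: lerD; rewrite ler_norml; apply/andP; split; lra.
have -> : g w = f (z + (w - z)) - f z - D * (w - z).
  by rewrite /g [z + (w - z)]addrC subrK; ring.
apply: le_trans (Hr _ _) _; first by apply: le_lt_trans wz _; rewrite pE.
by rewrite ler_wpM2l// ltW.
Qed.

(** Cut out a small square around [z0]. The four remaining rectangles avoid [z0] and contribute 0,
    while boundedness near [z0] makes the contour of the square at most a constant times its side.
    This serves for difference quotients. *)
Lemma contour_eq0_of_cderiv_except f z0 a b c d :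
  a < Re z0 < b -> c < Im z0 < d -> continuous f ->
  (forall z, rect a b c d z -> z <> z0 -> exists D, cderiv f z D) ->
  contour f a b c d = 0.
Proof.
case: z0 => x y /= /andP[ax xb] /andP[cy yd] cf fd.
apply/eqP; rewrite -N_eq0 eq_le N_ge0 andbT leNgt; apply/negP => J0.
set e := N (contour f a b c d) in J0.
have /ccontP/(_ 1 ltr01)[r r0 Hr] := cf (x +i* y).
pose M := N (f (x +i* y)) + 1.
have M0 : 0 < M by rewrite ltr_wpDl ?N_ge0.
(* The square of half-side [t = u / 4] lies in the rectangle and within distance r of [z0], where
   |f| <= M; its contour is at most 16 * M * t <= e / 2. *)
set u := Num.min (Num.min (Num.min (x - a) (b - x)) (Num.min (y - c) (d - y)))
  (Num.min r (e / (8 * M))).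
pose t := u / 4.
have t0 : 0 < t.
  by rewrite divr_gt0// !lt_min !subr_gt0 ax xb cy yd r0 divr_gt0// mulr_gt0.
have tu : t * 4 = u by rewrite mulfVK.
have := lexx u; rewrite {2}/u !le_min -tu => /andP[/andP[/andP[t1 t2] /andP[t3 t4]] /andP[t5 t6]].
have Z a' b' c' d' : a <= a' -> a' < b' -> b' <= b -> c <= c' -> c' < d' -> d' <= d ->
    (forall z, rect a' b' c' d' z -> z <> x +i* y) -> contour f a' b' c' d' = 0.
  move=> aa' ab' bb' cc' cd' dd' H.
  apply: contour_eq0_of_cderiv => // z zin; apply: fd; last exact: H.
  case: zin => /andP[? ?] /andP[? ?].
  by split; apply/andP; split; lra.
have E : contour f a b c d = contour f (x - t) (x + t) (y - t) (y + t).
  rewrite (contour_split_Re f a (x - t) b) (contour_split_Re f (x - t) (x + t) b).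
  rewrite (contour_split_Im f (x - t) (x + t) c (y - t) d).
  rewrite (contour_split_Im f (x - t) (x + t) (y - t) (y + t) d).
  rewrite (_ : contour f a (x - t) c d = 0); last first.
    apply: Z; [lra|lra|lra|lra|lra|lra|].
    by move=> z [/andP[u1 u2] _] zE; rewrite zE /= in u1 u2; lra.
  rewrite (_ : contour f (x + t) b c d = 0); last first.
    apply: Z; [lra|lra|lra|lra|lra|lra|].
    by move=> z [/andP[u1 u2] _] zE; rewrite zE /= in u1 u2; lra.
  rewrite (_ : contour f (x - t) (x + t) c (y - t) = 0); last first.
    apply: Z; [lra|lra|lra|lra|lra|lra|].
    by move=> z [_ /andP[u1 u2]] zE; rewrite zE /= in u1 u2; lra.
  rewrite (_ : contour f (x - t) (x + t) (y + t) d = 0); last first.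
    apply: Z; [lra|lra|lra|lra|lra|lra|].
    by move=> z [_ /andP[u1 u2]] zE; rewrite zE /= in u1 u2; lra.
  by rewrite !add0r !addr0.
have : e <= 4 * M * ((x + t - (x - t)) + (y + t - (y - t))).
  rewrite /e E; apply: contour_le; [lra|lra|by move=> z _; exact: cf|].
  move=> z [/andP[? ?] /andP[? ?]] _.
  have : N (z - (x +i* y)) < r.
    apply: (@le_lt_trans _ _ (t + t)); last by lra.
    apply: le_trans (N_le_ReIm _) _; rewrite !ReImE /=.
    by apply: lerD; rewrite ler_norml; apply/andP; split; lra.
  move=> /Hr fz; rewrite /M.
  have -> : f z = f (x +i* y) + (f z - f (x +i* y)) by ring.
  by apply: le_trans (ND _ _) _; rewrite lerD2l.
move: t6; rewrite ler_pdivlMr ?mulr_gt0//.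
move=> t6 H.
by lra.
Qed.

End Goursat.

(** * Cauchy's formula on squares *)

Section CauchyKernel.
Context {R : realType}.
Implicit Types (f g mu : R[i] -> R[i]) (z w : R[i]) (a b c d s : R).

Lemma compact_rect a b c d : compact [set z : R[i] | rect a b c d z].
Proof.
have -> : [set z : R[i] | rect a b c d z] =
    (fun p : R * R => p.1 +i* p.2) @` (`[a, b] `*` `[c, d]).
  apply/seteqP; split=> [z [zr zi]|_ [p [p1 p2] <-]].
    by exists (Re z, Im z); [split; rewrite /= in_itv | apply: C_eqP].
  by move: p1 p2; rewrite /= !in_itv.
apply: continuous_compact; last by apply: compact_setX; exact: segment_compact.
apply: continuous_subspaceT => p.
by apply: cvg_Complex; [exact: cvg_fst | exact: cvg_snd].
Qed.

Lemma continuous_N : continuous (fun z : R[i] => N z).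
Proof.
move=> z; apply/(@cvgrPdist_le _ _ _ (nbhs z) (nbhs_filter z)) => e e0.
apply/nbhs_N; exists e => // w /ltW; apply: le_trans.
have := ND (w - z) z; have := ND (z - w) w; rewrite !subrK (NBC z w) => H1 H2.
by rewrite ler_norml; apply/andP; split; lra.
Qed.

Lemma continuous_bounded_rect f a b c d : a <= b -> c <= d -> continuous f ->
  exists2 M, 0 < M & forall z, rect a b c d z -> N (f z) <= M.
Proof.
move=> ab cd cf.
have ne : [set z : R[i] | rect a b c d z] !=set0.
  by exists (a +i* c); split; rewrite /= lexx.
have cN : {within [set z : R[i] | rect a b c d z], continuous (fun z => N (f z))}.
  apply: continuous_subspaceT => z.
  by apply: (@continuous_comp _ _ _ f (fun z => N z)); [exact: cf | exact: continuous_N].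
have [u _ Hu] := compact_EVT_max ne (@compact_rect a b c d) cN.
exists (N (f u) + 1); first by rewrite ltr_wpDl ?N_ge0.
move=> z zin; apply: (@le_trans _ _ (N (f u))); last by rewrite lerDl.
by apply: Hu; rewrite inE.
Qed.

Lemma sidelines_le_N s z : 0 <= s -> sidelines (- s) s (- s) s z -> s <= N z.
Proof.
move=> s0 [] E.
- by apply: le_trans (Re_le_N z); rewrite E normrN ger0_norm.
- by apply: le_trans (Re_le_N z); rewrite E ger0_norm.
- by apply: le_trans (Im_le_N z); rewrite E normrN ger0_norm.
- by apply: le_trans (Im_le_N z); rewrite E ger0_norm.
Qed.

(* Cauchy-type integral over the boundary of the square [|Re|, |Im| <= s]. *)
Definition transform s mu (k : R[i] -> R[i]) z :=
  contour (fun w => mu w * k (w - z)) (- s) s (- s) s.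

Lemma sidelines_neq s z w : N z < s -> sidelines (- s) s (- s) s w -> w - z != 0.
Proof.
move=> zs ws; rewrite subr_eq0; apply/eqP => wz; move: ws; rewrite wz.
have s0 : 0 <= s by apply: le_trans (ltW zs); exact: N_ge0.
by move=> /(sidelines_le_N s0); rewrite leNgt zs.
Qed.

Lemma transform_cont s mu k z : N z < s -> continuous mu ->
  (forall v, v != 0 -> {for v, continuous k}) ->
  contour_cont (fun w => mu w * k (w - z)) (- s) s (- s) s.
Proof.
move=> zs cmu ck w ws; apply: ccontM; first exact: cmu.
have cB : {for w, continuous (fun w => w - z)}.
  by apply: ccontB; [exact: ccont_id | exact: ccont_cst].
by apply: (ccont_comp cB); apply: ck; exact: sidelines_neq ws.
Qed.

Lemma contour_cont_comb f g k (h : R[i]) a b c d :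
  contour_cont f a b c d -> contour_cont g a b c d -> contour_cont k a b c d ->
  contour_cont (fun w => f w + ((-1) * g w + (- h) * k w)) a b c d.
Proof.
move=> cf cg ck.
have cZ u p : contour_cont p a b c d -> contour_cont (fun w => u * p w) a b c d.
  by move=> cp w ws; apply: ccontM; [exact: ccont_cst | exact: cp].
by move=> w ws; exact: (ccontD (cf w ws) (ccontD (cZ (-1) _ cg w ws) (cZ (- h) _ ck w ws))).
Qed.

Lemma contour_comb f g k (h : R[i]) a b c d : a <= b -> c <= d ->
  contour_cont f a b c d -> contour_cont g a b c d -> contour_cont k a b c d ->
  contour f a b c d - contour g a b c d - contour k a b c d * h =
  contour (fun w => f w + ((-1) * g w + (- h) * k w)) a b c d.
Proof.
move=> ab cd cf cg ck.
have cZ u p : contour_cont p a b c d -> contour_cont (fun w => u * p w) a b c d.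
  by move=> cp w ws; apply: ccontM; [exact: ccont_cst | exact: cp].
rewrite (contourD ab cd cf (fun w ws => ccontD (cZ (-1) _ cg w ws) (cZ (- h) _ ck w ws))).
rewrite (contourD ab cd (cZ (-1) _ cg) (cZ (- h) _ ck)).
by rewrite (contourZ (-1) ab cd cg) (contourZ (- h) ab cd ck); ring.
Qed.

(** Differentiation under the integral sign: |w - z| >= s - |z| on the sides, so the second-order
    remainder of the kernel is O(|h|^2) uniformly in w. *)
Lemma cderiv_transform s mu (k k' : R[i] -> R[i]) z : N z < s -> continuous mu ->
  (forall v, v != 0 -> {for v, continuous k}) ->
  (forall v, v != 0 -> {for v, continuous k'}) ->
  (forall eta, 0 < eta -> exists2 C, 0 < C & forall v h, 2 * eta <= N v -> N h < eta ->
     N (k (v - h) - k v - h * k' v) <= C * N h ^+ 2) ->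
  cderiv (transform s mu k) z (transform s mu k' z).
Proof.
move=> zs cmu ck ck' kk' e e0.
have s0 : 0 < s by apply: le_lt_trans zs; exact: N_ge0.
have ss : - s <= s by lra.
pose eta := (s - N z) / 2.
have eta0 : 0 < eta by rewrite divr_gt0// subr_gt0.
have [C C0 HC] := kk' _ eta0.
have [M M0 HM] := continuous_bounded_rect ss ss cmu.
(* In [contour_le] the sides add up to 4 * s, so a bound M * C * |h|^2 on the integrand gives 16 * s
   * M * C * |h|^2. *)
have D0 : 0 < 16 * s * M * C by rewrite !mulr_gt0.
exists (Num.min eta (e / (16 * s * M * C))).
  by rewrite lt_min eta0 divr_gt0.
move=> h; rewrite lt_min => /andP[he]; rewrite ltr_pdivlMr// => hC.
have zhs : N (z + h) < s.
  by apply: le_lt_trans (ND _ _) _; rewrite /eta in he; lra.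
have E : transform s mu k (z + h) - transform s mu k z - transform s mu k' z * h =
    contour (fun w => mu w * k (w - (z + h)) +
      ((-1) * (mu w * k (w - z)) + (- h) * (mu w * k' (w - z)))) (- s) s (- s) s.
  exact: (contour_comb _ ss ss (transform_cont zhs cmu ck)
    (transform_cont zs cmu ck) (transform_cont zs cmu ck')).
rewrite E.
have bound w : rect (- s) s (- s) s w -> sidelines (- s) s (- s) s w ->
    N (mu w * k (w - (z + h)) +
      ((-1) * (mu w * k (w - z)) + (- h) * (mu w * k' (w - z)))) <= M * (C * N h ^+ 2).
  move=> win ws.
  have -> : mu w * k (w - (z + h)) +
      ((-1) * (mu w * k (w - z)) + (- h) * (mu w * k' (w - z))) =
      mu w * (k ((w - z) - h) - k (w - z) - h * k' (w - z)).
    by rewrite (_ : w - (z + h) = w - z - h); ring.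
  rewrite NM; apply: ler_pM; rewrite ?N_ge0//; first exact: HM.
  apply: HC => //; rewrite /eta mulrCA mulfV// mulr1.
  have := sidelines_le_N (ltW s0) ws.
  have := ND (w - z) z; rewrite subrK; lra.
apply: le_trans (contour_le ss ss _ bound) _.
  exact: (contour_cont_comb (transform_cont zhs cmu ck)
    (transform_cont zs cmu ck) (transform_cont zs cmu ck')).
have -> : 4 * (M * (C * N h ^+ 2)) * (s - - s + (s - - s)) =
   (N h * (16 * s * M * C)) * N h by ring.
by rewrite ler_wpM2r ?N_ge0// ltW.
Qed.

Lemma cderiv_transform1 s mu z : N z < s -> continuous mu ->
  cderiv (transform s mu (fun v => v^-1)) z (transform s mu (fun v => (v ^+ 2)^-1) z).
Proof.
move=> zs cmu; apply: (cderiv_transform zs cmu).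
- by move=> v v0; apply: ccontV => //; exact: ccont_id.
- move=> v v0; apply: ccontV; first by rewrite expf_neq0.
  by apply: ccontM; exact: ccont_id.
(* The remainder equals h^2 / (v^2 (v - h)), and [eta] bounds both |v| and |v - h| from below. *)
move=> eta eta0; exists (eta ^+ 3)^-1; first by rewrite invr_gt0 exprn_gt0.
move=> v h v2 he.
have Nv : eta <= N v by lra.
have Nvh : eta <= N (v - h) by have := ND (v - h) h; rewrite subrK; lra.
have v0 : v != 0 by rewrite -N_gt0; apply: lt_le_trans Nv.
have vh0 : v - h != 0 by rewrite -N_gt0; apply: lt_le_trans Nvh.
have -> : (v - h)^-1 - v^-1 - h * (v ^+ 2)^-1 = (v ^+ 2 * (v - h))^-1 * h ^+ 2.
  by field; rewrite v0 vh0.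
rewrite NM NX NV ler_wpM2r ?exprn_ge0 ?N_ge0// NM NX.
rewrite lef_pV2 ?posrE ?mulr_gt0 ?exprn_gt0 ?N_gt0//.
rewrite exprSr; apply: ler_pM => //; [exact: exprn_ge0 (ltW eta0)|exact: ltW|].
by rewrite ler_pXn2r ?nnegrE ?N_ge0// ltW.
Qed.

Lemma cderiv_transform2 s mu z : N z < s -> continuous mu ->
  cderiv (transform s mu (fun v => (v ^+ 2)^-1)) z
    (transform s mu (fun v => 2 * (v ^+ 3)^-1) z).
Proof.
move=> zs cmu; apply: (cderiv_transform zs cmu).
- move=> v v0; apply: ccontV; first by rewrite expf_neq0.
  by apply: ccontM; exact: ccont_id.
- move=> v v0; apply: ccontM; first exact: ccont_cst.
  apply: ccontV; first by rewrite expf_neq0.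
  by apply: ccontM; [exact: ccont_id | apply: ccontM; exact: ccont_id].
move=> eta eta0; exists (3 * (eta ^+ 4)^-1).
  by rewrite mulr_gt0// invr_gt0 exprn_gt0.
move=> v h v2 he.
have Nv : eta <= N v by lra.
have Nvh : eta <= N (v - h) by have := ND (v - h) h; rewrite subrK; lra.
have v0 : v != 0 by rewrite -N_gt0; apply: lt_le_trans Nv.
have vh0 : v - h != 0 by rewrite -N_gt0; apply: lt_le_trans Nvh.
have -> : ((v - h) ^+ 2)^-1 - (v ^+ 2)^-1 - h * (2 * (v ^+ 3)^-1) =
   (((v * (v - h)) ^+ 2)^-1 + 2 * (v ^+ 3 * (v - h))^-1) * h ^+ 2.
  by field; rewrite v0 vh0.
rewrite NM NX ler_wpM2r ?exprn_ge0 ?N_ge0//.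
apply: le_trans (ND _ _) _; rewrite NM.
rewrite N_natr.
have H1 : N ((v * (v - h)) ^+ 2)^-1 <= (eta ^+ 4)^-1.
  rewrite NV NX NM lef_pV2 ?posrE ?exprn_gt0 ?mulr_gt0 ?N_gt0//.
  rewrite -[4%N]/(2 * 2)%N exprM.
  rewrite ler_pXn2r ?nnegrE ?sqr_ge0 ?mulr_ge0 ?N_ge0//.
  by rewrite expr2; apply: ler_pM => //; exact: ltW.
have H2 : N (v ^+ 3 * (v - h))^-1 <= (eta ^+ 4)^-1.
  rewrite NV NM NX lef_pV2 ?posrE ?exprn_gt0 ?mulr_gt0 ?exprn_gt0 ?N_gt0//.
  rewrite exprSr; apply: ler_pM => //; [exact: exprn_ge0 (ltW eta0)|exact: ltW|].
  by rewrite ler_pXn2r ?nnegrE ?N_ge0// ltW.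
by lra.
Qed.

(** The value 2 pi i is never computed, since the integral only serves as a divisor. Its imaginary
    part is positive: each side contributes a positive amount, as [z] lies on the inner side of
    it. *)
Lemma transform_inv_neq0 s z : N z < s ->
  transform s (fun=> 1) (fun v => v^-1) z != 0.
Proof.
move=> zs; have s0 : 0 < s by apply: le_lt_trans zs; exact: N_ge0.
have ss : - s < s by lra.
have zr := le_lt_trans (Re_le_N z) zs; have zi := le_lt_trans (Im_le_N z) zs.
move: zr zi; rewrite !ltr_norml => /andP[zr1 zr2] /andP[zi1 zi2].
have cont : contour_cont (fun w => 1 * (w - z)^-1) (- s) s (- s) s.
  apply: (@transform_cont s (fun=> 1) (fun v => v^-1)) => //.
    by move=> w; exact: ccont_cst.
  by move=> v v0; apply: ccontV => //; exact: ccont_id.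
have [cB _] := contour_cont_bottom cont; have [_ cB'] := contour_cont_bottom cont.
have [cT _] := contour_cont_top cont; have [_ cT'] := contour_cont_top cont.
have [cL _] := contour_cont_left cont; have [cR _] := contour_cont_right cont.
suff : 0 < Im (transform s (fun=> 1) (fun v => v^-1) z).
  by move=> H; apply/eqP => E; move: H; rewrite E ltxx.
have posR (x y : R) : x != 0 -> 0 < x ^+ 2 + y ^+ 2.
  by move=> x0; rewrite ltr_pwDl ?sqr_ge0// exprn_even_gt0.
have posI (x y : R) : y != 0 -> 0 < x ^+ 2 + y ^+ 2.
  by move=> x0; rewrite addrC posR.
have ImV (v : R[i]) : Im v^-1 = - Im v / (Re v ^+ 2 + Im v ^+ 2).
  by case: v => x y /=; rewrite mulNr.
have ReV (v : R[i]) : Re v^-1 = Re v / (Re v ^+ 2 + Im v ^+ 2).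
  by case: v.
have hB : 0 < rint (fun x => Im (1 * (x +i* (- s) - z)^-1)) (- s) s.
  apply: rint_gt0 => // x _; rewrite mul1r ImV !ReImE /=.
  by apply: divr_gt0; [lra | apply: posI; rewrite lt_eqF//; lra].
have hT : 0 < rint (fun x => - 1 * Im (1 * (x +i* s - z)^-1)) (- s) s.
  apply: rint_gt0 => //; first by move=> x; apply: cvgMr; exact: cT'.
  move=> x _; rewrite mul1r ImV !ReImE /= mulN1r -mulNr opprK.
  by apply: divr_gt0; [lra | apply: posI; rewrite gt_eqF//; lra].
have hR : 0 < rint (fun y => Re (1 * (s +i* y - z)^-1)) (- s) s.
  apply: rint_gt0 => // x _; rewrite mul1r ReV !ReImE /=.
  by apply: divr_gt0; [lra | apply: posR; rewrite gt_eqF//; lra].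
have hL : 0 < rint (fun y => - 1 * Re (1 * (- s +i* y - z)^-1)) (- s) s.
  apply: rint_gt0 => //; first by move=> x; apply: cvgMr; exact: cL.
  move=> x _; rewrite mul1r ReV !ReImE /= mulN1r -mulNr.
  by apply: divr_gt0; [lra | apply: posR; rewrite lt_eqF//; lra].
move: hT hL; rewrite !rintZ ?ltW// => hT hL.
rewrite /transform /contour /cint !ReImE /=; lra.
Qed.

End CauchyKernel.

(** * The Cauchy formula and differentiability of the derivative *)

Section CauchyFormula.
Context {R : realType}.
Implicit Types (f g : R[i] -> R[i]) (z w : R[i]) (s : R).

(** The projection onto [-s, s]. Precomposition with [cclamp] turns a function continuous near a
    square into one continuous on the whole plane, as integrals defined along full lines demand. *)
Definition clamp s (x : R) : R := Num.max (- s) (Num.min s x).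

Lemma clamp_id s x : `|x| <= s -> clamp s x = x.
Proof.
by rewrite ler_norml => /andP[x1 x2]; rewrite /clamp (min_idPr x2) (max_idPr x1).
Qed.

Lemma clamp_le s x : 0 <= s -> `|clamp s x| <= s.
Proof.
move=> s0; rewrite /clamp ler_norml le_max lexx /=.
by rewrite ge_max ge_min lexx /= andbT; lra.
Qed.

Lemma clamp_lip s x y : `|clamp s x - clamp s y| <= `|x - y|.
Proof.
have := ler_norm (x - y); have := ler_norm (y - x); rewrite (distrC y x) => H1 H2.
rewrite /clamp ler_norml.
have [sx|sx] := leP s x; have [sy|sy] := leP s y; rewrite !maxEle.
- by case: ifP => ?; apply/andP; split; lra.
- by do 2 case: ifP => ?; apply/andP; split; lra.
- by do 2 case: ifP => ?; apply/andP; split; lra.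
- by do 2 case: ifP => ?; apply/andP; split; lra.
Qed.

Definition cclamp s z := clamp s (Re z) +i* clamp s (Im z).

Lemma cclamp_id s z : N z <= s -> cclamp s z = z.
Proof.
move=> zs; apply: C_eqP; rewrite /= clamp_id //.
  exact: le_trans (Re_le_N _) zs.
exact: le_trans (Im_le_N _) zs.
Qed.

Lemma N_cclamp s z : 0 <= s -> N (cclamp s z) <= 2 * s.
Proof.
move=> s0; apply: le_trans (N_le_ReIm _) _ => /=.
by have := clamp_le (Re z) s0; have := clamp_le (Im z) s0; lra.
Qed.

Lemma continuous_cclamp s : continuous (cclamp s).
Proof.
move=> z; apply/ccontP => e e0; exists (e / 2) => [|w wz].
  by rewrite divr_gt0.
apply: le_trans (N_le_ReIm _) _; rewrite !ReImE /=.
have := le_trans (clamp_lip s (Re w) (Re z)) (_ : _ <= N (w - z)).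
rewrite -cReN -cReD => /(_ (Re_le_N _)).
have := le_trans (clamp_lip s (Im w) (Im z)) (_ : _ <= N (w - z)).
rewrite -cImN -cImD => /(_ (Im_le_N _)); lra.
Qed.

Lemma cderiv_unique f z d d' : cderiv f z d -> cderiv f z d' -> d = d'.
Proof. by move=> /cderivP[_ <-] /cderivP[_ <-]. Qed.

Section Formula.
Variables (f f' : R[i] -> R[i]) (s : R).
Hypothesis s0 : 0 < s.
Hypothesis fd : forall z, N z < 9 * s -> cderiv f z (f' z).

(** The radii fit together: [cclamp (4 * s)] has values of modulus at most 8 * s < 9 * s; [F] agrees
    with [f] for |z| <= 4 * s, so it has derivative [f'] for |z| <= 3 * s; and the square of
    half-side [s] lies in |z| <= 2 * s. *)
Let F z := f (cclamp (4 * s) z).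

Let s4 : 0 <= 4 * s. Proof. by have := s0; lra. Qed.

Lemma continuous_clamped : continuous F.
Proof.
move=> z; apply: (ccont_comp (@continuous_cclamp (4 * s) z)).
apply: (@cderiv_continuous _ _ _ (f' (cclamp (4 * s) z))).
by apply: fd; apply: le_lt_trans (N_cclamp _ s4) _; have := s0; lra.
Qed.

Lemma clamped_id z : N z <= 4 * s -> F z = f z.
Proof. by move=> zs; rewrite /F cclamp_id. Qed.

Lemma cderiv_clamped z : N z <= 3 * s -> cderiv F z (f' z).
Proof.
move=> zs; apply: (@cderiv_near _ f _ _ _ s) => //.
  move=> w wz; rewrite clamped_id//.
  by have := ND (w - z) z; rewrite subrK; lra.
by apply: fd; have := s0; lra.
Qed.

(** The difference quotient at [z], completed by the value [f' z], is continuous, and differentiable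
    on the square away from [z], so its contour vanishes by [contour_eq0_of_cderiv_except].
    Splitting the numerator gives the formula. *)
Lemma cauchy_formula z : N z < s ->
  f z * transform s (fun=> 1) (fun v => v^-1) z = transform s F (fun v => v^-1) z.
Proof.
move=> zs.
pose g w := if w == z then f' z else (F w - f z) * (w - z)^-1.
have gE w : w != z -> g w = (F w - f z) * (w - z)^-1.
  by rewrite /g => /negbTE->.
have Fz : F z = f z by apply: clamped_id; have := s0; lra.
have near_neq w : w != z -> forall v, N (v - w) < N (w - z) ->
    (F v - f z) * (v - z)^-1 = g v.
  move=> wz v vw; rewrite gE//; apply/eqP => vz.
  by move: vw; rewrite vz NBC ltxx.
have Nwz w : w != z -> 0 < N (w - z) by rewrite N_gt0 subr_eq0.
have gd w : N w <= 2 * s -> w <> z -> exists D, cderiv g w D.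
  move=> ws /eqP wz; eexists.
  apply: (cderiv_near (Nwz _ wz) (near_neq _ wz)).
  apply: cderivM.
    apply: cderivB; last exact: cderiv_const.
    by apply: cderiv_clamped; have := s0; lra.
  apply: cderivV; first by rewrite subr_eq0.
  by apply: cderivB; [exact: cderiv_id | exact: cderiv_const].
have cg : continuous g.
  move=> w; have [->|wz] := eqVneq w z; last first.
    apply: (ccont_near (Nwz _ wz) (near_neq _ wz)).
    apply: ccontM; last apply: ccontV; first last.
    - by apply: ccontB; [exact: ccont_id | exact: ccont_cst].
    - by rewrite subr_eq0.
    - by apply: ccontB; [exact: continuous_clamped | exact: ccont_cst].
  apply/ccontP => e e0.
  have zs3 : N z <= 3 * s by have := s0; lra.
  have [r r0 Hr] := cderiv_clamped zs3 e0.
  exists r => // v wr; rewrite {2}/g eqxx.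
  have [->|wz] := eqVneq v z; first by rewrite /g eqxx subrr N0 ltW.
  rewrite gE//.
  have := Hr _ wr; rewrite [z + _]addrC subrK Fz => H.
  have -> : (F v - f z) * (v - z)^-1 - f' z = (F v - f z - f' z * (v - z)) / (v - z).
    by field; rewrite subr_eq0.
  by rewrite NM NV ler_pdivrMr ?Nwz.
have zr := le_lt_trans (Re_le_N z) zs; have zi := le_lt_trans (Im_le_N z) zs.
move: zr zi; rewrite !ltr_norml => zr zi.
have ss : - s <= s by have := s0; lra.
have g0 : contour g (- s) s (- s) s = 0.
  apply: (@contour_eq0_of_cderiv_except _ g z) => // w [wr wi] wz.
  apply: gd => //; apply: le_trans (N_le_ReIm _) _.
  by rewrite -ler_norml in wr; rewrite -ler_norml in wi; lra.
have ckV v : v != 0 -> {for v, continuous (fun v : R[i] => v^-1)}.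
  by move=> v0; apply: ccontV => //; exact: ccont_id.
have c1 := transform_cont zs continuous_clamped ckV.
have c2 : contour_cont (fun w => 1 * (w - z)^-1) (- s) s (- s) s.
  by apply: (transform_cont zs _ ckV) => w; exact: ccont_cst.
have c3 : contour_cont (fun w => (- f z) * (1 * (w - z)^-1)) (- s) s (- s) s.
  by move=> w ws; apply: ccontM; [exact: ccont_cst | exact: c2].
have : contour (fun w => F w * (w - z)^-1 + (- f z) * (1 * (w - z)^-1)) (- s) s (- s) s
    = 0.
  rewrite -g0; apply: eq_contour => w ws; rewrite gE; first by ring.
  by rewrite -subr_eq0 (sidelines_neq zs ws).
rewrite (contourD ss ss c1 c3) (contourZ _ ss ss c2) mulNr => /eqP.
by rewrite subr_eq0 => /eqP.
Qed.

(* The formula reads [f * W = T] with [W] and [T] twice differentiable and   *)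
(* [W] nonvanishing, so [f' = (T' - f * W') / W] is differentiable at 0.     *)
Lemma cderiv_cderiv : exists f2 : R[i], cderiv f' 0 f2.
Proof.
have c1 : continuous (fun _ : R[i] => 1 : R[i]) by move=> w; exact: ccont_cst.
have cF := continuous_clamped.
have N00 : N (0 : R[i]) < s by rewrite N0.
pose W := transform s (fun=> 1) (fun v => v^-1).
have H z : N (z - 0) < s ->
    (transform s F (fun v => (v ^+ 2)^-1) z
     - f z * transform s (fun=> 1) (fun v => (v ^+ 2)^-1) z) * (W z)^-1 = f' z.
  rewrite subr0 => zs.
  have W0 := transform_inv_neq0 zs.
  have d1 := cderiv_transform1 zs cF; have d2 := cderiv_transform1 zs c1.
  have zs9 : N z < 9 * s by have := s0; lra.
  have d3 := cderivM (fd zs9) d2.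
  have := cderiv_near (r := s - N z) _ _ d3.
  move=> /(_ (transform s F (fun v => v^-1))).
  rewrite subr_gt0 => /(_ zs) H.
  have := cderiv_unique (H _) d1 => {}H.
  rewrite -H; first by rewrite /W; field.
  move=> w ws; apply: cauchy_formula.
  by have := ND (w - z) z; rewrite subrK; lra.
eexists; apply: (cderiv_near s0 H); apply: cderivM.
  apply: cderivB; first exact: cderiv_transform2.
  apply: cderivM; last exact: cderiv_transform2.
  by apply: fd; rewrite N0 mulr_gt0.
by apply: cderivV; [exact: transform_inv_neq0 | exact: cderiv_transform1].
Qed.

End Formula.

(** Translation to 0 and the choice [s = r / 9] reduce this to [cderiv_cderiv]. *)
Lemma cderiv_derivative f f' z0 (r : R) : 0 < r ->
  (forall z, N (z - z0) < r -> cderiv f z (f' z)) -> exists f2 : R[i], cderiv f' z0 f2.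
Proof.
move=> r0 fd.
pose g z := f (z0 + 1 * z); pose g' z := f' (z0 + 1 * z).
have gd z : N z < 9 * (r / 9) -> cderiv g z (g' z).
  move=> zr; rewrite -[g' z]mulr1; apply: cderiv_affine; apply: fd.
  by rewrite mul1r addrAC subrr add0r; lra.
have [f2 H] := cderiv_cderiv (divr_gt0 r0 (ltr0Sn _ 8)) gd.
exists f2.
apply: (@cderiv_near _ (fun z => g' (- z0 + 1 * z)) _ _ _ 1) => //.
  by move=> w _; rewrite /g'; congr f'; ring.
rewrite -[f2]mulr1; apply: cderiv_affine.
by rewrite mul1r addNr.
Qed.

(** Along the segment from z to z + h the remainder has derivative at most e / 2 * |h|^2, by
    differentiability of [f'] at [z]. The mean value theorem applies to its real and imaginary parts
    separately, which restores the factor 2. *)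
Lemma cderiv_taylor2 f f' z (f2 : R[i]) (r : R) : 0 < r ->
  (forall w, N (w - z) < r -> cderiv f w (f' w)) -> cderiv f' z f2 ->
  forall e, 0 < e -> exists2 r', 0 < r' & forall h, N h < r' ->
    N (f (z + h) - f z - f' z * h - f2 / 2 * h ^+ 2) <= e * N h ^+ 2.
Proof.
move=> r0 fd f'd e e0.
have e2 : 0 < e / 2 by rewrite divr_gt0.
have [s s0 Hs] := f'd _ e2.
exists (Num.min r s) => [|h]; first by rewrite lt_min r0.
rewrite lt_min => /andP[hr hs].
pose G (t : R) := f (z + h * t%:C) - f z - f' z * (h * t%:C) - f2 / 2 * (h * t%:C) ^+ 2.
pose G' (t : R) := (f' (z + h * t%:C) - f' z - f2 * (h * t%:C)) * h.
have Gd t : 0 <= t <= 1 -> pderiv G t (G' t).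
  move=> /andP[t0 t1].
  have NhtE : N (h * t%:C) <= N h.
    by rewrite NM NR ger0_norm// ler_piMr ?N_ge0.
  have ht : N (z + h * t%:C - z) < r by rewrite addrAC subrr add0r; lra.
  pose Q w := f (z + h * w) - f z - f' z * (h * w) - f2 / 2 * (h * w * (h * w)).
  have Qd : cderiv Q t%:C (G' t).
    apply: cderiv_eq; last first.
      apply: cderivB; last first.
        apply: cderivM; first exact: cderiv_const.
        by apply: cderivM; (apply: cderivM; [exact: cderiv_const | exact: cderiv_id]).
      apply: cderivB; last first.
        apply: cderivM; first exact: cderiv_const.
        by apply: cderivM; [exact: cderiv_const | exact: cderiv_id].
      apply: cderivB; last exact: cderiv_const.
      by apply: cderiv_affine; exact: fd.
    by rewrite /G' /=; field.
  have -> : G = fun t => Q (t +i* 0) by apply/funext => u; rewrite /G /Q expr2.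
  exact: pderiv_horizontal.
have bound t : 0 <= t <= 1 -> N (G' t) <= e / 2 * N h ^+ 2.
  move=> /andP[t0 t1].
  have NhtE : N (h * t%:C) <= N h.
    by rewrite NM NR ger0_norm// ler_piMr ?N_ge0.
  rewrite /G' NM expr2 mulrA ler_wpM2r ?N_ge0//.
  apply: le_trans (Hs _ _) _; first exact: le_lt_trans hs.
  by rewrite ler_wpM2l// ltW.
have G0 : G 0 = 0 by rewrite /G; rewrite (_ : 0%:C = 0 :> R[i])// !mulr0 addr0 expr0n /= mulr0; ring.
have G1 : G 1 = f (z + h) - f z - f' z * h - f2 / 2 * h ^+ 2.
  by rewrite /G (_ : 1%:C = 1 :> R[i])// mulr1.
rewrite -G1.
have [c1 hc1 E1] := rderiv_MVT ler01 (fun t ht => pderiv_Re (Gd t ht)).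
have [c2 hc2 E2] := rderiv_MVT ler01 (fun t ht => pderiv_Im (Gd t ht)).
move: E1 E2; rewrite G0 !subr0 !mulr1 => E1 E2.
apply: le_trans (N_le_ReIm _) _; rewrite E1 E2.
have := le_trans (Re_le_N _) (bound _ hc1).
have := le_trans (Im_le_N _) (bound _ hc2); lra.
Qed.

End CauchyFormula.

(** * Second-order jets and Laplacians *)

Section Jets.
Context {R : realType}.
Implicit Types (v u : R[i] -> R) (f g : R[i] -> R[i]) (z w h al be : R[i]) (ga : R).

Definition o2 (p : R[i] -> R) := forall e, 0 < e -> exists2 r, 0 < r &
  forall h, N h < r -> `|p h| <= e * N h ^+ 2.

Lemma o2_dominated p q r C : 0 < r -> 0 < C -> o2 q ->
  (forall h, N h < r -> `|p h| <= C * (N h ^+ 3 + `|q h|)) -> o2 p.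
Proof.
move=> r0 C0 oq pq e e0.
have e2 : 0 < e / C / 2 by rewrite !divr_gt0.
have [s s0 Hs] := oq _ e2.
exists (Num.min (Num.min r s) (e / C / 2)); first by rewrite !lt_min r0 s0.
move=> h; rewrite !lt_min => /andP[/andP[hr hs] hC].
apply: le_trans (pq _ hr) _; rewrite -ler_pdivlMl//.
have -> : C^-1 * (e * N h ^+ 2) = e / C / 2 * N h ^+ 2 + e / C / 2 * N h ^+ 2.
  by field; rewrite gt_eqF.
apply: lerD; last exact: Hs.
by rewrite exprS ler_wpM2r ?exprn_ge0 ?N_ge0// ltW.
Qed.

(* The quadratic part splits into a harmonic term and [ga |h|^2]: [4 ga] is  *)
(* the Laplacian of [v] at [z], and [al] encodes its gradient.               *)
Definition jet v z al ga := exists be, o2 (fun h =>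
  v (z + h) - v z - (Re (al * h) + Re (be * h ^+ 2) + ga * N h ^+ 2)).

Lemma jetD u v z al al' ga ga' : jet u z al ga -> jet v z al' ga' ->
  jet (fun w => u w + v w) z (al + al') (ga + ga').
Proof.
move=> [be Hu] [be' Hv]; exists (be + be') => e e0.
have e2 : 0 < e / 2 by rewrite divr_gt0.
have [r r0 Hr] := Hu _ e2; have [s s0 Hs] := Hv _ e2.
exists (Num.min r s); first by rewrite lt_min r0.
move=> h; rewrite lt_min => /andP[/Hr H1 /Hs H2].
have -> : e * N h ^+ 2 = e / 2 * N h ^+ 2 + e / 2 * N h ^+ 2 by field.
apply: le_trans (lerD H1 H2); apply: le_trans (ler_normD _ _).
by rewrite le_eqVlt; apply/orP; left; apply/eqP; congr `| _ |; rewrite !ReImE; ring.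
Qed.

Lemma jet_near u v z al ga r : 0 < r ->
  (forall w, N (w - z) < r -> u w = v w) -> jet u z al ga -> jet v z al ga.
Proof.
move=> r0 uv [be H]; exists be => e /H[s s0 Hs].
exists (Num.min r s); first by rewrite lt_min r0.
move=> h; rewrite lt_min => /andP[hr hs].
rewrite -!uv ?Hs// ?subrr ?N0// addrAC subrr add0r//.
Qed.

(** Summing the expansion over h = t, -t, it, -it cancels both the linear and the harmonic quadratic
    terms and leaves 4 * ga * t^2 up to an error of half that size. *)
Lemma jet_max v z al ga r : 0 < r -> jet v z al ga ->
  (forall w, N (w - z) < r -> v w <= v z) -> ga <= 0.
Proof.
move=> r0 [be H] vmax; rewrite leNgt; apply/negP => ga0.
have [s s0 Hs] := H (ga / 2) (divr_gt0 ga0 (ltr0Sn _ 1)).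
pose t := Num.min r s / 2.
have m0 : 0 < Num.min r s by rewrite lt_min r0.
have t0 : 0 < t by rewrite divr_gt0.
have tm : t < Num.min r s by rewrite /t; lra.
move: tm; rewrite lt_min => /andP[tr ts]; clearbody t.
have Ni : N ('i : R[i]) = 1 by rewrite /= expr0n expr1n add0r sqrtr1.
have Nt : N (t%:C) = t by rewrite NR gtr0_norm.
have K h : N h = t -> - (ga / 2 * t ^+ 2) + ga * t ^+ 2 <= - (Re (al * h) + Re (be * h ^+ 2)).
  move=> ht; have := vmax (z + h); rewrite addrAC subrr add0r ht => /(_ tr) vle.
  have := Hs h; rewrite ht => /(_ ts); rewrite ler_norml => /andP[+ _]; lra.
have K1 := K t%:C Nt.
have K2 : N (- t%:C) = t by rewrite NN.
have {}K2 := K _ K2.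
have K3 : N ('i * t%:C) = t by rewrite NM Ni mul1r.
have {}K3 := K _ K3.
have K4 : N (- ('i * t%:C)) = t by rewrite NN NM Ni mul1r.
have {}K4 := K _ K4.
have tt : 0 < ga * t ^+ 2 by rewrite mulr_gt0// exprn_gt0.
have sq : (t%:C : R[i]) ^+ 2 = (t ^+ 2)%:C by rewrite rmorphXn.
move: K1 K2 K3 K4; rewrite !sqrrN !exprMn sqr_i mulN1r !mulrN sq !ReImE /=; lra.
Qed.

Definition peano (phi : R -> R) t (a b : R) := forall e, 0 < e -> exists2 r, 0 < r &
  forall d, `|d| < r -> `|phi (t + d) - phi t - a * d - b / 2 * d ^+ 2| <= e * d ^+ 2.

Lemma peano_rderiv phi phi' t b r : 0 < r ->
  (forall s, `|s - t| < r -> rderiv phi s (phi' s)) -> rderiv phi' t b ->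
  peano phi t (phi' t) b.
Proof.
move=> r0 pd p'd e e0.
have [s s0 Hs] := p'd _ e0.
exists (Num.min r s) => [|d]; first by rewrite lt_min r0.
rewrite lt_min => /andP[dr ds].
have shift (F : R -> R) x D : rderiv F (t + d * x) D -> rderiv (fun y => F (t + d * y)) x (D * d).
  move=> /rderivP H; apply/rderivP.
  have H2 : is_derive x 1 (fun y => t + d * y) d.
    apply/rderivP; rewrite -[X in rderiv _ _ X]add0r -[X in rderiv _ _ (_ + X)]mulr1.
    apply: rderivD; first exact: rderiv_const.
    by apply: rderivZ; apply/rderivP; exact: is_derive_id.
  by have := @is_derive1_comp _ F (fun y => t + d * y) x D d H H2.
have xd x : 0 <= x <= 1 -> `|d * x| <= `|d|.
  by move=> /andP[x0 x1]; rewrite normrM (ger0_norm x0) ler_piMr.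
pose G x := phi (t + d * x) - phi t - phi' t * d * x - b / 2 * d ^+ 2 * (x * x).
have Gd x : 0 <= x <= 1 -> rderiv G x ((phi' (t + d * x) - phi' t - b * (d * x)) * d).
  move=> x01.
  have -> : (phi' (t + d * x) - phi' t - b * (d * x)) * d =
     phi' (t + d * x) * d - 0 - phi' t * d * 1 - b / 2 * d ^+ 2 * (x * 1 + x * 1) by field.
  apply: rderivB; last first.
    apply: rderivZ; apply/rderivP; exact: is_deriveM.
  apply: rderivB; last first.
    by apply: rderivZ; apply/rderivP; exact: is_derive_id.
  apply: rderivB; last exact: rderiv_const.
  apply: shift; apply: pd; rewrite addrAC subrr add0r.
  exact: le_lt_trans (xd _ x01) _.
have [c c01] := rderiv_MVT ler01 Gd.
rewrite subr0 mulr1 => E.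
have -> : phi (t + d) - phi t - phi' t * d - b / 2 * d ^+ 2 = G 1 - G 0.
  by rewrite /G !mulr1 !mulr0 addr0; ring.
rewrite E normrM.
have -> : e * d ^+ 2 = e * `|d| * `|d|.
  by rewrite -mulrA -expr2 -normrX ger0_norm ?sqr_ge0.
rewrite ler_wpM2r//; apply: le_trans (Hs _ _) _.
  exact: le_lt_trans (xd _ c01) _.
by rewrite ler_wpM2l ?xd// ltW.
Qed.

(** Separates the square of a linear term into a rotation-invariant part, which feeds the Laplacian,
    and a harmonic part. *)
Lemma Re_sqr al h : Re (al * h) ^+ 2 = N al ^+ 2 * N h ^+ 2 / 2 + Re (al ^+ 2 * h ^+ 2) / 2.
Proof.
by rewrite !N_sqr -exprMn; case: al h => a b [c d] /=; rewrite expr2 /=; field.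
Qed.

Lemma ReCM (c : R) z : Re (c%:C * z) = c * Re z.
Proof. by rewrite cReM /= mul0r subr0. Qed.

(** The chain rule Lap phi(v) = phi' Lap v + phi'' |grad v|^2, with Lap v = 4 ga and |grad v| =
    |al|. *)
Lemma jet_comp phi v z al ga a b : peano phi (v z) a b -> jet v z al ga ->
  jet (fun w => phi (v w)) z (a%:C * al) (a * ga + b * N al ^+ 2 / 4).
Proof.
move=> pphi [be Hv].
exists (a%:C * be + (b / 4)%:C * al ^+ 2).
pose rho h := v (z + h) - v z - (Re (al * h) + Re (be * h ^+ 2) + ga * N h ^+ 2).
pose L h := Re (al * h); pose Q h := Re (be * h ^+ 2) + ga * N h ^+ 2.
pose D h := v (z + h) - v z.
pose eta h := phi (v z + D h) - phi (v z) - a * D h - b / 2 * D h ^+ 2.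
have [r r0 Hr] := Hv 1 ltr01.
pose q := N be + `|ga| + 1; pose K := N al + q.
have q1 : 1 <= q by rewrite /q; have := N_ge0 be; have := normr_ge0 ga; lra.
have Lle h : `|L h| <= N al * N h by rewrite -NM; exact: Re_le_N.
have Qle h : N h < r -> `|Q h + rho h| <= q * N h ^+ 2.
  move=> /Hr rle; apply: le_trans (ler_normD _ _) _.
  have Q1 : `|Q h| <= N be * N h ^+ 2 + `|ga| * N h ^+ 2.
    apply: le_trans (ler_normD _ _) _; apply: lerD.
      by rewrite -NX -NM; exact: Re_le_N.
    by rewrite normrM (@ger0_norm _ (N h ^+ 2)) ?exprn_ge0 ?N_ge0.
  by move: rle; rewrite /q -/(rho h); lra.
clearbody q.
have DE h : D h = L h + (Q h + rho h) by rewrite /D /L /Q /rho; ring.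
have Dle h : N h < r -> N h < 1 -> `|D h| <= K * N h.
  move=> hr h1; rewrite DE; apply: le_trans (ler_normD _ _) _.
  apply: le_trans (lerD (Lle h) (Qle h hr)) _.
  rewrite /K mulrDl lerD2l ler_wpM2l//; first lra.
  by rewrite expr2 ler_piMl ?N_ge0// ltW.
have K0 : 0 < K by rewrite /K; have := N_ge0 al; lra.
have oeta : o2 eta.
  move=> e e0; have eK : 0 < e / K ^+ 2 by rewrite divr_gt0 ?exprn_gt0.
  have [s s0 Hs] := pphi _ eK.
  exists (Num.min (Num.min r 1) (s / K)); first by rewrite !lt_min r0 ltr01 divr_gt0.
  move=> h; rewrite !lt_min => /andP[/andP[hr h1]]; rewrite ltr_pdivlMr// mulrC => hs.
  apply: le_trans (Hs _ _) _; first exact: le_lt_trans (Dle _ hr h1) hs.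
  rewrite mulrAC ler_pdivrMr ?exprn_gt0// -mulrA ler_wpM2l ?(ltW e0)//.
  rewrite -exprMn [N h * K]mulrC -(@ger0_norm _ (D h ^+ 2)) ?sqr_ge0// normrX.
  by rewrite ler_pXn2r ?nnegrE ?mulr_ge0 ?N_ge0 ?(ltW K0)// Dle.
have orho : o2 rho := Hv.
pose T h := `|rho h| + `|eta h|.
have oT : o2 T.
  move=> e e0; have e2 : 0 < e / 2 by rewrite divr_gt0.
  have [s s0 Hs] := orho _ e2; have [s' s0' Hs'] := oeta _ e2.
  exists (Num.min s s'); first by rewrite lt_min s0.
  move=> h; rewrite lt_min => /andP[/Hs H1 /Hs' H2].
  by rewrite /T ger0_norm ?addr_ge0//; lra.
pose C := `|a| + 1 + `|b| * (N al * q + q ^+ 2).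
have m1 : 0 <= `|b| * (N al * q + q ^+ 2).
  by rewrite mulr_ge0// addr_ge0 ?mulr_ge0 ?N_ge0 ?sqr_ge0//; lra.
have C0 : 0 < C by rewrite /C; have := normr_ge0 a; lra.
have rm : 0 < Num.min r 1 by rewrite lt_min r0 ltr01.
apply: (o2_dominated rm C0 oT) => h; rewrite lt_min => /andP[hr h1].
(* By [Re_sqr] the square of the linear part [L h] is accounted for exactly; each remaining term is
   O(|h|^3) or controlled by [rho] and [eta]. *)
have -> : phi (v (z + h)) - phi (v z) - (Re (a%:C * al * h) +
    Re ((a%:C * be + (b / 4)%:C * al ^+ 2) * h ^+ 2) +
    (a * ga + b * N al ^+ 2 / 4) * N h ^+ 2) =
    a * rho h + eta h + b / 2 * (2 * L h * (Q h + rho h) + (Q h + rho h) ^+ 2).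
  have -> : v (z + h) = v z + D h by rewrite /D; ring.
  have -> : Re (a%:C * al * h) = a * L h by rewrite /L -mulrA ReCM.
  have -> : Re ((a%:C * be + (b / 4)%:C * al ^+ 2) * h ^+ 2) =
      a * Re (be * h ^+ 2) + b / 4 * Re (al ^+ 2 * h ^+ 2).
    by rewrite mulrDl -(mulrA a%:C) -(mulrA (b / 4)%:C) cReD !ReCM.
  have := Re_sqr al h; rewrite -/(L h) => E.
  have {}E : Re (al ^+ 2 * h ^+ 2) = 2 * L h ^+ 2 - N al ^+ 2 * N h ^+ 2 by rewrite E; field.
  by rewrite E /eta !DE /Q; field.
have H1 : `|2 * L h * (Q h + rho h)| <= 2 * (N al * q) * N h ^+ 3.
  rewrite !normrM (@ger0_norm _ 2)//.
  have -> : 2 * (N al * q) * N h ^+ 3 = 2 * (N al * N h) * (q * N h ^+ 2) by ring.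
  by apply: ler_pM; [exact: mulr_ge0 | by [] | rewrite ler_wpM2l | exact: Qle].
have H2 : `|(Q h + rho h) ^+ 2| <= q ^+ 2 * N h ^+ 3.
  rewrite normrX; apply: (@le_trans _ _ ((q * N h ^+ 2) ^+ 2)).
    have q2 : 0 <= q * N h ^+ 2 by apply: mulr_ge0; [lra | exact: sqr_ge0].
    by rewrite ler_pXn2r ?nnegrE//; exact: Qle.
  rewrite exprMn ler_wpM2l ?sqr_ge0// -exprM (exprS _ 3) ler_piMl ?exprn_ge0 ?N_ge0//.
  exact: ltW.
apply: le_trans (ler_normD _ _) _.
have H3 : `|b / 2 * (2 * L h * (Q h + rho h) + (Q h + rho h) ^+ 2)| <=
    `|b| * (N al * q + q ^+ 2) * N h ^+ 3.
  rewrite normrM; apply: (@le_trans _ _ (`|b / 2| * (2 * (N al * q) * N h ^+ 3 + q ^+ 2 * N h ^+ 3))).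
    by rewrite ler_wpM2l//; apply: le_trans (ler_normD _ _) (lerD H1 H2).
  rewrite normrM (@ger0_norm _ 2^-1) ?invr_ge0// -[leLHS]mulrA -[leRHS]mulrA ler_wpM2l//.
  have : 0 <= q ^+ 2 * N h ^+ 3 by rewrite mulr_ge0 ?sqr_ge0 ?exprn_ge0 ?N_ge0.
  lra.
have H4 : `|a * rho h + eta h| <= (`|a| + 1) * T h.
  apply: le_trans (ler_normD _ _) _; rewrite normrM /T mulrDl mul1r.
  have : 0 <= `|a| * `|eta h| by rewrite mulr_ge0.
  have := normr_ge0 (rho h); lra.
have T0 : 0 <= T h by rewrite addr_ge0.
rewrite (ger0_norm T0) /C.
have : 0 <= (`|a| + 1) * N h ^+ 3 by rewrite mulr_ge0 ?addr_ge0 ?exprn_ge0 ?N_ge0.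
have : 0 <= `|b| * (N al * q + q ^+ 2) * T h by rewrite mulr_ge0.
by move: H3 H4; lra.
Qed.

End Jets.

(** * Logarithms of moduli of holomorphic functions *)

Section LogNorm.
Context {R : realType}.
Implicit Types (f g : R[i] -> R[i]) (z w h : R[i]).

(** Here [b] stands for half of the second derivative, whereas [peano] writes the factor 1/2
    explicitly. *)
Definition taylor2 f z (a b : R[i]) := forall e, 0 < e -> exists2 r, 0 < r &
  forall h, N h < r -> N (f (z + h) - f z - a * h - b * h ^+ 2) <= e * N h ^+ 2.

Lemma cReJ z : Re (conjc z) = Re z. Proof. by case: z. Qed.
Lemma cImJ z : Im (conjc z) = - Im z. Proof. by case: z. Qed.
Lemma NJ z : N (conjc z) = N z. Proof. by case: z => x y /=; rewrite sqrrN. Qed.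

Lemma N_sqr_expand A B C E :
  N (A + B + (C + E)) ^+ 2 - N A ^+ 2 -
    (2 * Re (conjc A * B) + 2 * Re (conjc A * C) + N B ^+ 2) =
  2 * Re (conjc A * E) + 2 * Re (conjc B * (C + E)) + N (C + E) ^+ 2 :> R.
Proof. by rewrite !N_sqr !ReImE !cReJ !cImJ; ring. Qed.

(** In the expansion of |f(z) + a h + b h^2|^2 the only second-order term that is not harmonic is |a
    h|^2, so the Laplacian of |f|^2 is 4 |f'|^2. *)
Lemma jet_N_sqr f z a b : taylor2 f z a b ->
  jet (fun w => N (f w) ^+ 2) z ((2 : R)%:C * (conjc (f z) * a)) (N a ^+ 2).
Proof.
move=> ft; exists ((2 : R)%:C * (conjc (f z) * b)).
pose E h := f (z + h) - f z - a * h - b * h ^+ 2.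
have oE : o2 (fun h => N (E h)).
  by move=> e /ft[r r0 Hr]; exists r => // h /Hr; rewrite ger0_norm ?N_ge0.
have [r r0 Hr] := ft 1 ltr01.
pose q := N b + 1; pose C := 2 * N (f z) + 2 * N a * q + q ^+ 2 + 1.
have q1 : 1 <= q by rewrite /q lerDr N_ge0.
have C0 : 0 < C.
  rewrite /C; have : 0 <= N a * q by rewrite mulr_ge0 ?N_ge0//; lra.
  by have := N_ge0 (f z); have := sqr_ge0 q; lra.
have rm : 0 < Num.min r 1 by rewrite lt_min r0 ltr01.
apply: (o2_dominated rm C0 oE) => h; rewrite lt_min => /andP[hr h1].
have Fle : N (b * h ^+ 2 + E h) <= q * N h ^+ 2.
  by apply: le_trans (ND _ _) _; rewrite NM NX /q mulrDl lerD2l Hr.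
have -> : N (f (z + h)) ^+ 2 - N (f z) ^+ 2 -
    (Re ((2 : R)%:C * (conjc (f z) * a) * h) +
     Re ((2 : R)%:C * (conjc (f z) * b) * h ^+ 2) + N a ^+ 2 * N h ^+ 2) =
    2 * Re (conjc (f z) * E h) + 2 * Re (conjc (a * h) * (b * h ^+ 2 + E h)) +
    N (b * h ^+ 2 + E h) ^+ 2.
  rewrite -N_sqr_expand.
  have -> : f (z + h) = f z + a * h + (b * h ^+ 2 + E h) by rewrite /E; ring.
  have rA u v : Re ((2 : R)%:C * u * v) = 2 * Re (u * v) by rewrite -mulrA ReCM.
  by rewrite !rA NM exprMn !mulrA.
have h0 := N_ge0 h.
have H1 : `|2 * Re (conjc (f z) * E h)| <= 2 * N (f z) * N (E h).
  by rewrite normrM (@ger0_norm _ 2)// -mulrA ler_wpM2l// -(NJ (f z)) -NM Re_le_N.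
have H2 : `|2 * Re (conjc (a * h) * (b * h ^+ 2 + E h))| <= 2 * N a * q * N h ^+ 3.
  rewrite normrM (@ger0_norm _ 2)// -!mulrA ler_wpM2l//.
  apply: le_trans (Re_le_N _) _; rewrite NM NJ NM -mulrA ler_wpM2l ?N_ge0//.
  by apply: le_trans (ler_wpM2l h0 Fle) _; rewrite mulrCA -exprS.
have H3 : `|N (b * h ^+ 2 + E h) ^+ 2| <= q ^+ 2 * N h ^+ 3.
  rewrite ger0_norm ?sqr_ge0//; apply: (@le_trans _ _ ((q * N h ^+ 2) ^+ 2)).
    have q2 : 0 <= q * N h ^+ 2 by apply: mulr_ge0; [lra | exact: sqr_ge0].
    by rewrite ler_pXn2r ?nnegrE ?N_ge0//.
  rewrite exprMn ler_wpM2l ?sqr_ge0// -exprM (exprS _ 3) ler_piMl ?exprn_ge0//.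
  exact: ltW.
apply: le_trans (ler_normD _ _) _; apply: le_trans (lerD (ler_normD _ _) H3) _.
rewrite (ger0_norm (N_ge0 (E h))).
have X1 : 0 <= N h ^+ 3 by rewrite exprn_ge0.
have X2 := N_ge0 (E h).
have X3 : 0 <= 2 * N (f z) * N h ^+ 3 by rewrite !mulr_ge0 ?N_ge0.
have X4 : 0 <= (2 * N a * q + q ^+ 2) * N (E h).
  by rewrite mulr_ge0// addr_ge0 ?sqr_ge0// !mulr_ge0 ?N_ge0//; lra.
by rewrite /C; lra.
Qed.

Lemma rderiv_ln (x : R) : 0 < x -> rderiv (@ln R) x x^-1.
Proof. by move=> x0; apply/rderivP; exact: is_derive1_ln. Qed.

Lemma rderiv_expR (x : R) : rderiv (@expR R) x (expR x).
Proof. by apply/rderivP; exact: is_derive_expR. Qed.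

Lemma rderiv_inv (x : R) : x != 0 -> rderiv (@GRing.inv R) x (- (x ^+ 2)^-1).
Proof.
by move=> x0; rewrite -[X in rderiv _ _ X]mulr1; exact: (rderivV x0 (rderiv_id x)).
Qed.

Lemma peano_ln (x : R) : 0 < x -> peano (@ln R) x x^-1 (- (x ^+ 2)^-1).
Proof.
move=> x0; apply: (@peano_rderiv _ _ (@GRing.inv R) _ _ x) => // [s|].
  by rewrite ltr_norml => /andP[s1 s2]; apply: rderiv_ln; lra.
by apply: rderiv_inv; rewrite gt_eqF.
Qed.

Definition lnN2 f w : R := ln (N (f w) ^+ 2).

(** Harmonicity of ln |f|^2: for phi = ln the terms phi' |f'|^2 and phi'' |2 conj(f) f'|^2 / 4 of
    [jet_comp] cancel. *)
Lemma jet_lnN2 f z a b : f z != 0 -> taylor2 f z a b ->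
  jet (lnN2 f) z ((N (f z) ^+ 2)^-1%:C * ((2 : R)%:C * (conjc (f z) * a))) 0.
Proof.
move=> fz ft; have p0 : 0 < N (f z) ^+ 2 by rewrite exprn_gt0// N_gt0.
have := jet_comp (peano_ln p0) (jet_N_sqr ft).
have -> : (N (f z) ^+ 2)^-1 * N a ^+ 2 + - ((N (f z) ^+ 2) ^+ 2)^-1 *
    N ((2 : R)%:C * (conjc (f z) * a)) ^+ 2 / 4 = 0.
  by rewrite !NM NJ NR ger0_norm//; field; rewrite N_eq0.
by [].
Qed.

(** As ln |f|^2 is harmonic with gradient of length 2 |f' / f|, only the phi'' term of [jet_comp]
    survives. *)
Lemma jet_comp_lnN2 phi f z a b k l : f z != 0 -> taylor2 f z a b ->
  peano phi (lnN2 f z) k l ->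
  exists al, jet (fun w => phi (lnN2 f w)) z al (l * (N a ^+ 2 / N (f z) ^+ 2)).
Proof.
move=> fz ft pp; eexists.
have := jet_comp pp (jet_lnN2 fz ft).
rewrite mulr0 add0r.
have -> : l * N ((N (f z) ^+ 2)^-1%:C * ((2 : R)%:C * (conjc (f z) * a))) ^+ 2 / 4 =
    l * (N a ^+ 2 / N (f z) ^+ 2).
  rewrite !NM NJ !NR !ger0_norm ?invr_ge0 ?sqr_ge0//.
  by field; rewrite N_eq0.
by apply.
Qed.

End LogNorm.

(** * Ahlfors' method *)

Section Ahlfors.
Context {R : realType}.
Implicit Types (f g : R[i] -> R[i]) (u v : R[i] -> R) (z w h : R[i]).

Lemma peano_scale (c t : R) : peano (fun x => c * x) t c 0.
Proof.
move=> e e0; exists 1 => // d _.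
have -> : c * (t + d) - c * t - c * d - 0 / 2 * d ^+ 2 = 0 by ring.
by rewrite normr0 mulr_ge0 ?sqr_ge0// ltW.
Qed.

Lemma peano_ln_sub (c t : R) : t < c ->
  peano (fun s => ln (c - s)) t (- (c - t)^-1) (- ((c - t) ^+ 2)^-1).
Proof.
move=> tc.
have sub s : rderiv (fun s => c - s) s (0 - 1).
  by apply: rderivB; [exact: rderiv_const | exact: rderiv_id].
apply: (@peano_rderiv _ _ (fun s => - (c - s)^-1) _ _ (c - t)).
- by rewrite subr_gt0.
- move=> s; rewrite ltr_norml => /andP[s1 s2].
  rewrite -[X in rderiv _ _ X]mulrN1 -[- 1]sub0r.
  by apply: rderiv_comp => //; apply: rderiv_ln; lra.
have ct : c - t != 0 by rewrite subr_eq0 gt_eqF.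
have -> : - ((c - t) ^+ 2)^-1 = 0 - (- ((c - t) ^+ 2)^-1 * (0 - 1)) by ring.
have -> : (fun s => - (c - s)^-1) = (fun s => 0 - (c - s)^-1).
  by apply/funext => s; rewrite sub0r.
by apply: rderivB; [exact: rderiv_const | exact: rderivV].
Qed.

Lemma taylor2_id z : taylor2 id z 1 0.
Proof.
move=> e e0; exists 1 => // h _.
have -> : z + h - z - 1 * h - 0 * h ^+ 2 = 0 by ring.
by rewrite N0 mulr_ge0 ?exprn_ge0 ?N_ge0// ltW.
Qed.

(** The curvature identity of the Poincare metric, whose density is proportional to 1 / (r^2 -
    |w|^2). *)
Lemma jet_ln_disc z (r : R) : N z < r ->
  exists al, jet (fun w => ln (r ^+ 2 - N w ^+ 2)) z al
    (- (r ^+ 2 / (r ^+ 2 - N z ^+ 2) ^+ 2)).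
Proof.
move=> zr; have zr2 : N z ^+ 2 < r ^+ 2.
  have := N_ge0 z => z0; rewrite ltr_pXn2r// nnegrE; lra.
eexists; have := jet_comp (peano_ln_sub zr2) (jet_N_sqr (@taylor2_id z)).
have -> : - (r ^+ 2 - N z ^+ 2)^-1 * N 1 ^+ 2 + - ((r ^+ 2 - N z ^+ 2) ^+ 2)^-1 *
    N ((2 : R)%:C * (conjc z * 1)) ^+ 2 / 4 = - (r ^+ 2 / (r ^+ 2 - N z ^+ 2) ^+ 2).
  by rewrite !NM NJ NR ger0_norm// N1; field; rewrite subr_eq0 gt_eqF.
by apply.
Qed.

(* At a local maximum of [e^u |g| (r^2 - |w|^2)] the logarithm has nonpositive *)
(* Laplacian; [log |g|] being harmonic, the curvature condition on [u] bounds *)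
(* the maximum.                                                               *)
Lemma ahlfors_at_max u g z (r s k : R) a b al ga :
  N z < r -> 0 < s -> g z != 0 -> {for z, continuous g} ->
  taylor2 g z a b -> jet u z al ga ->
  k * expR (u z) ^+ 2 * N (g z) ^+ 2 <= ga ->
  (forall w, N (w - z) < s -> expR (u w) * N (g w) * (r ^+ 2 - N w ^+ 2) <=
     expR (u z) * N (g z) * (r ^+ 2 - N z ^+ 2)) ->
  k * (expR (u z) * N (g z) * (r ^+ 2 - N z ^+ 2)) ^+ 2 <= r ^+ 2.
Proof.
move=> zr s0 gz cg gt ju kga zmax.
have [al1 j1] := jet_ln_disc zr.
have [al2 j2] := jet_comp_lnN2 gz gt (@peano_scale (1 / 2) (lnN2 g z)).
have jv := jetD (jetD ju j2) j1.
have disc w : N w < r -> 0 < r ^+ 2 - N w ^+ 2.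
  move=> wr; have := N_ge0 w => w0; rewrite subr_gt0 ltr_pXn2r// nnegrE; lra.
have q0 := disc _ zr.
pose V w := u w + 1 / 2 * lnN2 g w + ln (r ^+ 2 - N w ^+ 2).
have VE w : g w != 0 -> N w < r ->
    expR (V w) = expR (u w) * N (g w) * (r ^+ 2 - N w ^+ 2).
  move=> gw wr; rewrite /V !expRD lnK ?posrE ?disc//; congr (_ * _ * _).
  rewrite /lnN2 lnXn ?N_gt0// mulr2n.
  have -> : 1 / 2 * (ln (N (g w)) + ln (N (g w))) = ln (N (g w)) by field.
  by rewrite lnK// posrE N_gt0.
have gz2 : 0 < N (g z) / 2 by rewrite divr_gt0 ?N_gt0.
have /ccontP/(_ _ gz2)[t t0 Ht] := cg.
have m0 : 0 < Num.min (Num.min s t) (r - N z) by rewrite !lt_min s0 t0 subr_gt0.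
have jm := jet_max m0 jv.
have Vmax w : N (w - z) < Num.min (Num.min s t) (r - N z) -> V w <= V z.
  rewrite !lt_min => /andP[/andP[ws wt] wr].
  have gw : g w != 0.
    rewrite -N_gt0; have := Ht _ wt; have := ND (g z - g w) (g w).
    by rewrite subrK (NBC (g z)); lra.
  have wr' : N w < r by have := ND (w - z) z; rewrite subrK; lra.
  by rewrite -ler_expR !VE ?zmax.
move: (jm Vmax); rewrite mul0r addr0 subr_le0 => gale.
have := le_trans kga gale; rewrite ler_pdivlMr ?exprn_gt0//.
by rewrite !exprMn !mulrA.
Qed.

(** The maximum is taken over a compact square inside |z| < 4; beyond |z| < 2 the last factor is
    nonpositive, so only a maximum inside the disc matters. There [4 <= k * B ^+ 2] turns the
    conclusion of [ahlfors_at_max] for radius 2 into the bound [B]. The alternative in the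
    hypothesis lets one density take over where another has already given the bound. *)
Lemma ahlfors_bound u g (g' : R[i] -> R[i]) (B k : R) :
  (forall z, N z < 4 -> cderiv g z (g' z)) ->
  (forall z, N z < 4 -> {for z, continuous u}) ->
  0 <= B -> 0 < k -> 4 <= k * B ^+ 2 ->
  (forall z, N z < 2 -> expR (u z) * N (g z) * (2 ^+ 2 - N z ^+ 2) <= B \/
     exists al ga, jet u z al ga /\ k * expR (u z) ^+ 2 * N (g z) ^+ 2 <= ga) ->
  forall z, N z < 2 -> expR (u z) * N (g z) * (2 ^+ 2 - N z ^+ 2) <= B.
Proof.
move=> gd cu B0 k0 kB curv z z2.
have rect4 w : rect (- 2) 2 (- 2) 2 w -> N w < 4.
  move=> [w1 w2].
  have : N w ^+ 2 < 4 ^+ 2.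
    rewrite N_sqr; have : Re w ^+ 2 <= 4 /\ Im w ^+ 2 <= 4.
      by case/andP: w1 => ? ?; case/andP: w2 => ? ?; split; nra.
    by lra.
  by rewrite ltr_pXn2r ?nnegrE ?N_ge0//.
pose F w := expR (u w) * N (g w) * (2 ^+ 2 - N w ^+ 2).
have cF : {within [set w : R[i] | rect (- 2) 2 (- 2) 2 w], continuous F}.
  apply: continuous_in_subspaceT => w; rewrite inE/= => /rect4 w4.
  have cN : {for w, continuous (fun w : R[i] => N w)} by exact: continuous_N.
  have cg : {for w, continuous (fun w => N (g w))}.
    have cg0 := cderiv_continuous (gd _ w4).
    exact: (continuous_comp cg0 (@continuous_N R (g w))).
  have ce : {for w, continuous (fun w => expR (u w))}.
    exact: (continuous_comp (cu _ w4) (@continuous_expR R (u w))).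
  have c2 : {for w, continuous (fun w : R[i] => 2 ^+ 2 - N w ^+ 2)}.
    apply: (@continuousB _ R^o _ (cst (2 ^+ 2)) (fun w : R[i] => N w ^+ 2)).
      exact: cst_continuous.
    exact: (continuousM cN cN).
  exact: (continuousM (continuousM ce cg) c2).
have ne : [set w : R[i] | rect (- 2) 2 (- 2) 2 w] !=set0.
  by exists 0; split; rewrite /=; apply/andP; split; lra.
have [m] := compact_EVT_max ne (@compact_rect R (- 2) 2 (- 2) 2) cF.
rewrite inE /= => mr Hm.
have {}Hm w : rect (- 2) 2 (- 2) 2 w -> F w <= F m by move=> wr; apply: Hm; rewrite inE.
have rect2 w : N w < 2 -> rect (- 2) 2 (- 2) 2 w.
  move=> w2; have := le_lt_trans (Re_le_N w) w2; have := le_lt_trans (Im_le_N w) w2.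
  by rewrite !ltr_norml => /andP[? ?] /andP[? ?]; split; apply/andP; split; lra.
apply: le_trans (Hm _ (rect2 _ z2)) _.
have [m2|m2] := ltP (N m) 2; last first.
  apply: le_trans B0; rewrite /F mulr_ge0_le0 ?mulr_ge0 ?N_ge0 ?expR_ge0//.
  by rewrite subr_le0 ler_pXn2r ?nnegrE ?N_ge0//.
have [//|[al [ga [ju kga]]]] := curv _ m2.
have [g0|g0] := eqVneq (g m) 0; first by rewrite /F g0 N0 mulr0 mul0r.
have m4 : N m < 4 by lra.
have s0 : 0 < 2 - N m by lra.
have gdm w : N (w - m) < 2 - N m -> cderiv g w (g' w).
  by move=> wm; apply: gd; have := ND (w - m) m; rewrite subrK; lra.
have [g2 g'd] := cderiv_derivative s0 gdm.
have gt : taylor2 g m (g' m) (g2 / 2) := cderiv_taylor2 s0 gdm g'd.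
have H := ahlfors_at_max m2 s0 g0 (cderiv_continuous (gd _ m4)) gt ju kga.
have {}H : k * F m ^+ 2 <= 2 ^+ 2.
  apply: H => w wm; apply: Hm; apply: rect2.
  by have := ND (w - m) m; rewrite subrK; lra.
have F0 : 0 <= F m.
  rewrite /F mulr_ge0 ?mulr_ge0 ?N_ge0 ?expR_ge0// subr_ge0.
  by rewrite ler_pXn2r ?nnegrE ?N_ge0// ltW.
rewrite -(@ler_pXn2r _ 2)// -(ler_pM2l k0).
by apply: le_trans H _; rewrite -natrX.
Qed.

End Ahlfors.

(** * Schottky's theorem on the disc *)

Section Schottky.
Context {R : realType}.
Implicit Types (f g : R[i] -> R[i]) (u v : R[i] -> R) (z w h : R[i]).

(* [expR (rob t)], at [t = ln |w|^2], is the factor                          *)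
(* [(1 + |w|^(1/3))^(1/2) / |w|^(5/6)] of Robinson's metric.                 *)
Definition rob (t : R) := 1 / 2 * ln (1 + expR (6^-1 * t)) - 5 / 12 * t.

Lemma peano_rob t : exists k, peano rob t k
  (expR (6^-1 * t) / (72 * (1 + expR (6^-1 * t)) ^+ 2)).
Proof.
have ed (s : R) : rderiv (fun t => expR (6^-1 * t)) s (expR (6^-1 * s) * 6^-1).
  rewrite -[X in _ * X]mulr1.
  by apply: rderiv_comp; [exact: rderiv_expR | apply: rderivZ; exact: rderiv_id].
have e1d (s : R) : rderiv (fun t => 1 + expR (6^-1 * t)) s (expR (6^-1 * s) * 6^-1).
  by rewrite -[X in rderiv _ _ X]add0r; apply: rderivD => //; exact: rderiv_const.
have e0 (s : R) : 0 < 1 + expR (6^-1 * s) :> R by rewrite addr_gt0// expR_gt0.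
pose rob' (s : R) := 1 / 2 * ((1 + expR (6^-1 * s))^-1 * (expR (6^-1 * s) * 6^-1)) - 5 / 12 * 1.
exists (rob' t); apply: (@peano_rderiv _ _ rob' _ _ 1) => // [s _|].
  apply: rderivB; last by apply: rderivZ; exact: rderiv_id.
  by apply: rderivZ; apply: rderiv_comp => //; exact: rderiv_ln.
have -> : expR (6^-1 * t) / (72 * (1 + expR (6^-1 * t)) ^+ 2) =
    1 / 2 * ((1 + expR (6^-1 * t))^-1 * (expR (6^-1 * t) * 0 + 6^-1 * (expR (6^-1 * t) * 6^-1))
      + (expR (6^-1 * t) * 6^-1) * (- ((1 + expR (6^-1 * t)) ^+ 2)^-1 * (expR (6^-1 * t) * 6^-1)))
     - 0 by field; rewrite gt_eqF.
apply: rderivB; last exact: rderiv_const.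
apply: rderivZ; apply: rderivM; first by apply: rderivV => //; rewrite gt_eqF.
by apply: rderivM => //; exact: rderiv_const.
Qed.

Lemma expR_rob t : expR (rob t) ^+ 2 = (1 + expR (6^-1 * t)) / expR (6^-1 * t) ^+ 5.
Proof.
have e0 : 0 < 1 + expR (6^-1 * t) :> R by rewrite addr_gt0// expR_gt0.
rewrite -!expRM_natl -expRN -[X in _ = X * _](lnK (x := 1 + expR (6^-1 * t))) ?posrE//.
by rewrite -expRD; congr expR; rewrite /rob; field.
Qed.

(** Here x = |w|^(1/3) and y = |w - 1|^(1/3), or the reverse. The Laplacian term of the nearer
    puncture, with [y <= x], already suffices, because the distance to the farther one is bounded
    below. *)
Lemma rob_curvature (x y : R) : 0 < x -> 0 < y -> 1 <= x ^+ 3 + y ^+ 3 ->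
  (108 ^+ 2)^-1 * ((1 + x) / x ^+ 5 * ((1 + y) / y ^+ 5)) <=
  x / (72 * (1 + x) ^+ 2) / x ^+ 6 + y / (72 * (1 + y) ^+ 2) / y ^+ 6.
Proof.
wlog yx : x y / y <= x => [H x0 y0 xy|x0 y0 xy].
  have [yx|/ltW yx] := leP y x; first exact: H.
  have := H y x yx y0 x0; rewrite addrC => /(_ xy).
  by rewrite [X in (108 ^+ 2)^-1 * X]mulrC [leRHS]addrC.
have x2 : 1 / 2 <= x.
  rewrite leNgt; apply/negP => x2.
  have : y ^+ 3 <= x ^+ 3 by rewrite ler_pXn2r ?nnegrE// ltW.
  have : x ^+ 3 < (1 / 2) ^+ 3 by rewrite ltr_pXn2r ?nnegrE// ?ltW//; lra.
  by rewrite expr_div_n expr1n; lra.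
apply: (@le_trans _ _ (y / (72 * (1 + y) ^+ 2) / y ^+ 6)); last first.
  by rewrite lerDr !divr_ge0 ?mulr_ge0 ?exprn_ge0 ?addr_ge0 ?(ltW x0).
(* Over the common denominator the claim is (1 + x) (1 + y)^3 <= 162 x^5, with 162 = 108^2 / 72.
   Both 1 + x and 1 + y are at most 3 x, and 81 x^4 <= 162 x^5 as x >= 1/2. *)
have -> : y / (72 * (1 + y) ^+ 2) / y ^+ 6 =
    (162 * x ^+ 5) / (108 ^+ 2 * x ^+ 5 * y ^+ 5 * (1 + y) ^+ 2).
  by field; rewrite !gt_eqF// addr_gt0.
have -> : (108 ^+ 2)^-1 * ((1 + x) / x ^+ 5 * ((1 + y) / y ^+ 5)) =
    ((1 + x) * (1 + y) ^+ 3) / (108 ^+ 2 * x ^+ 5 * y ^+ 5 * (1 + y) ^+ 2).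
  by field; rewrite !gt_eqF// addr_gt0.
have d0 : 0 <= (108 ^+ 2 * x ^+ 5 * y ^+ 5 * (1 + y) ^+ 2)^-1.
  rewrite invr_ge0; apply: mulr_ge0; last exact: sqr_ge0.
  by apply: mulr_ge0; [apply: mulr_ge0; first exact: sqr_ge0|]; exact: exprn_ge0 (ltW _).
apply: ler_wpM2r => //.
have h1 : 1 + x <= 3 * x by lra.
have h2 : (1 + y) ^+ 3 <= (3 * x) ^+ 3.
  by rewrite ler_pXn2r ?nnegrE//; lra.
have y1 : 0 <= 1 + y by lra.
apply: le_trans (ler_pM _ _ h1 h2) _; rewrite ?exprn_ge0//; first lra.
have -> : 3 * x * (3 * x) ^+ 3 = 81 * x ^+ 4 by ring.
have : 0 <= x ^+ 4 * (x - 1 / 2) by rewrite mulr_ge0 ?exprn_ge0 ?(ltW x0)// subr_ge0.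
have -> : x ^+ 4 * (x - 1 / 2) = x ^+ 5 - x ^+ 4 / 2 by ring.
by lra.
Qed.

Lemma continuous_lnN2 f z : f z != 0 -> {for z, continuous f} ->
  {for z, continuous (lnN2 f)}.
Proof.
move=> fz cf.
have cN : {for z, continuous (fun w => N (f w))} by exact: (continuous_comp cf (@continuous_N R (f z))).
have c2 : {for z, continuous (fun w => N (f w) ^+ 2)} by exact: (continuousM cN cN).
have p0 : 0 < N (f z) ^+ 2 by rewrite exprn_gt0// N_gt0.
exact: (continuous_comp c2 (rderiv_continuous (rderiv_ln p0))).
Qed.

Lemma continuous_rob t : {for t, continuous rob}.
Proof.
have e0 : 0 < 1 + expR (6^-1 * t) :> R by rewrite addr_gt0// expR_gt0.
eapply rderiv_continuous; apply: rderivB; last by apply: rderivZ; exact: rderiv_id.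
apply: rderivZ; apply: rderiv_comp; first exact: rderiv_ln.
apply: rderivD; first exact: rderiv_const.
by apply: rderiv_comp; [exact: rderiv_expR | apply: rderivZ; exact: rderiv_id].
Qed.

Lemma expR6 w : w != 0 -> expR (6^-1 * ln (N w ^+ 2)) ^+ 3 = N w :> R.
Proof.
rewrite -N_gt0 => w0; rewrite lnXn// -expRM_natl -[RHS]lnK ?posrE//.
by congr expR; rewrite mulr2n; field.
Qed.

(** * Derivative bounds for a function omitting 0 and 1 *)

Section OmitsTwoValues.
Variables (f f' : R[i] -> R[i]).
Hypothesis fd : forall z, N z < 4 -> cderiv f z (f' z).
Hypothesis f01 : forall z, N z < 4 -> f z != 0 /\ f z != 1.

Let f1 z := f z - 1.

Let f1d z : N z < 4 -> cderiv f1 z (f' z).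
Proof.
by move=> /fd H; rewrite -[f' z]subr0; apply: cderivB => //; exact: cderiv_const.
Qed.

Let f10 z : N z < 4 -> f1 z != 0.
Proof. by move=> /f01[_]; rewrite subr_eq0. Qed.

Let f'd z : N z < 4 -> exists f2 : R[i], cderiv f' z f2.
Proof.
move=> z4; apply: (@cderiv_derivative _ f f' z (4 - N z)); first by rewrite subr_gt0.
by move=> w wz; apply: fd; have := ND (w - z) z; rewrite subrK; lra.
Qed.

Let f'E : exists f2, forall z, N z < 4 -> cderiv f' z (f2 z).
Proof.
exists (fun z => xget 0 [set f2 : R[i] | cderiv f' z f2]) => z /f'd.
exact: (@xgetPex _ 0).
Qed.

Let taylor g z : (forall w, N w < 4 -> cderiv g w (f' w)) -> N z < 4 ->
  exists b : R[i], taylor2 g z (f' z) b.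
Proof.
move=> gd z4; have [f2 f2d] := f'd z4; exists (f2 / 2).
apply: (@cderiv_taylor2 _ g f' z f2 (4 - N z)) => //; first by rewrite subr_gt0.
by move=> w wz; apply: gd; have := ND (w - z) z; rewrite subrK; lra.
Qed.

Let u w := rob (lnN2 f w) + rob (lnN2 f1 w).

Let u_sqr z : expR (u z) ^+ 2 =
  (1 + expR (6^-1 * lnN2 f z)) / expR (6^-1 * lnN2 f z) ^+ 5 *
  ((1 + expR (6^-1 * lnN2 f1 z)) / expR (6^-1 * lnN2 f1 z) ^+ 5).
Proof.
by rewrite -(expR_rob (lnN2 f z)) -(expR_rob (lnN2 f1 z)) -[RHS]exprMn -expRD.
Qed.

(** The hypothesis of [rob_curvature] is the triangle inequality 1 <= |f| + |f - 1|. With k = 1 /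
    108^2, the value 216 = 2 * 108 gives equality in [4 <= k * B ^+ 2]. *)
Lemma rob_bound z : N z < 2 -> expR (u z) * N (f' z) * (2 ^+ 2 - N z ^+ 2) <= 216.
Proof.
have [f2 f2d] := f'E.
move: z; apply: (@ahlfors_bound _ _ _ f2 216 (108 ^+ 2)^-1) => //.
- move=> z z4; have [fz _] := f01 z4.
  have c0 := continuous_lnN2 fz (cderiv_continuous (fd z4)).
  have c1 := continuous_lnN2 (f10 z4) (cderiv_continuous (f1d z4)).
  have d0 := continuous_comp c0 (@continuous_rob (lnN2 f z)).
  have d1 := continuous_comp c1 (@continuous_rob (lnN2 f1 z)).
  exact: (continuousD d0 d1).
- by lra.
move=> z z2; right; have z4 : N z < 4 by lra.
have [fz _] := f01 z4; have f1z := f10 z4.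
have [b tf] := taylor fd z4; have [b1 tf1] := taylor f1d z4.
have [k pk] := peano_rob (lnN2 f z); have [k1 pk1] := peano_rob (lnN2 f1 z).
have [al j] := jet_comp_lnN2 fz tf pk; have [al1 j1] := jet_comp_lnN2 f1z tf1 pk1.
exists (al + al1); eexists; split; first exact: jetD j j1.
rewrite [X in _ * X * _]u_sqr.
have := expR6 fz; have := expR6 f1z; rewrite -/(lnN2 f z) -/(lnN2 f1 z).
have := expR_gt0 (6^-1 * lnN2 f z); have := expR_gt0 (6^-1 * lnN2 f1 z).
move: (expR (6^-1 * lnN2 f z)) (expR (6^-1 * lnN2 f1 z)) => x y y0 x0 yE xE.
have xy : 1 <= x ^+ 3 + y ^+ 3.
  rewrite xE yE -[leLHS](@N1 R).
  have -> : 1 = f z - f1 z by rewrite /f1; ring.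
  exact: NB.
rewrite -[N (f z)]xE -[N (f1 z)]yE -!exprM -[(3 * 2)%N]/6%N.
have -> : x / (72 * (1 + x) ^+ 2) * (N (f' z) ^+ 2 / x ^+ 6) +
    y / (72 * (1 + y) ^+ 2) * (N (f' z) ^+ 2 / y ^+ 6) =
    (x / (72 * (1 + x) ^+ 2) / x ^+ 6 + y / (72 * (1 + y) ^+ 2) / y ^+ 6) * N (f' z) ^+ 2.
  by rewrite [RHS]mulrDl; congr (_ + _); ring.
exact: ler_wpM2r (sqr_ge0 _) _ _ (rob_curvature x0 y0 xy).
Qed.

(** Turns [rob_bound] into a bound on |f'|. Since |f| and |f - 1| are at most 3, their cube roots
    are at most 2, and each of the two factors of [expR (u z) ^+ 2] is at least 1/32. *)
Lemma rob_lower z : N z < 4 -> N (f z) <= 2 -> 1 / 32 <= expR (u z).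
Proof.
move=> z4 fz2; have [fz _] := f01 z4; have f1z := f10 z4.
rewrite -(@ler_pXn2r _ 2) ?nnegrE ?expR_ge0//.
rewrite u_sqr.
have := expR6 fz; have := expR6 f1z; rewrite -/(lnN2 f z) -/(lnN2 f1 z).
have := expR_gt0 (6^-1 * lnN2 f z); have := expR_gt0 (6^-1 * lnN2 f1 z).
move: (expR (6^-1 * lnN2 f z)) (expR (6^-1 * lnN2 f1 z)) => x y y0 x0 yE xE.
have x2 : x <= 2.
  by rewrite -(@ler_pXn2r _ 3) ?nnegrE ?(ltW x0)// xE; apply: le_trans fz2 _; lra.
have y2 : y <= 2.
  rewrite -(@ler_pXn2r _ 3) ?nnegrE ?(ltW y0)// yE /f1.
  by apply: le_trans (NB _ _) _; rewrite N1; lra.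
have lower (t : R) : 0 < t -> t <= 2 -> 1 / 32 <= (1 + t) / t ^+ 5.
  move=> t0 t2; rewrite ler_pdivlMr ?exprn_gt0//.
  have : t ^+ 5 <= 2 ^+ 5 by rewrite ler_pXn2r ?nnegrE ?(ltW t0).
  by lra.
rewrite expr2; apply: ler_pM; rewrite ?lower//; lra.
Qed.

(* [expR (- m / 2 - ln m)] is [1 / (|f| ln |f|^2)] where [|f| >= 2]; where   *)
(* [|f| < 2] it is frozen at a constant, and [rob_bound] applies.            *)
Let m w := Num.max (lnN2 f w) (ln 4).

(** Ensures that ln |f|^2 >= 1 where |f| >= 2, so that its own logarithm is nonnegative. *)
Lemma ln4_ge1 : 1 <= ln (4 : R).
Proof.
rewrite -ler_expR lnK ?posrE//.
have := expR_ge1Dx (- (1 / 2) : R); rewrite expRN => H.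
have e0 := expR_gt0 (1 / 2 : R).
have : expR (1 / 2) <= 2 :> R.
  by have := ler_wpM2l (ltW e0) H; rewrite mulfV ?gt_eqF//; lra.
move=> e2; have -> : expR 1 = expR (1 / 2) ^+ 2 :> R.
  by rewrite -expRM_natl; congr expR; field.
have -> : 4 = 2 ^+ 2 :> R by rewrite -natrX.
by rewrite ler_pXn2r ?nnegrE ?(ltW e0).
Qed.

Lemma cusp_bound z : N z < 2 ->
  expR (- (1 / 2) * m z - ln (m z)) * N (f' z) * (2 ^+ 2 - N z ^+ 2) <= (32 * 216).
Proof.
have [f2 f2d] := f'E.
move: z; apply: (@ahlfors_bound _ (fun z => - (1 / 2) * m z - ln (m z)) f' f2 (32 * 216) 1) => //.
- move=> z z4; have [fz _] := f01 z4.
  have c0 := continuous_lnN2 fz (cderiv_continuous (fd z4)).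
  have cm : {for z, continuous m}.
    by apply: (@continuous_max _ _ (lnN2 f) (cst (ln 4))) => //; exact: cst_continuous.
  have mz : 0 < m z by rewrite lt_max (lt_le_trans ltr01 ln4_ge1) orbT.
  have c1 := continuous_comp cm (rderiv_continuous (rderiv_ln mz)).
  have c2 : {for z, continuous (fun w => - (1 / 2) * m w)}.
    exact: (continuousM (@cst_continuous _ _ (- (1 / 2) : R) z) cm).
  exact: (continuousB c2 c1).
- by lra.
move=> z z2; have z4 : N z < 4 by lra.
have [fz _] := f01 z4.
have q0 : 0 <= 2 ^+ 2 - N z ^+ 2.
  by rewrite subr_ge0 ler_pXn2r ?nnegrE ?N_ge0// ltW.
have [fz4|fz4] := leP (lnN2 f z) (ln 4).
  left; have -> : m z = ln 4 by rewrite /m (max_idPr fz4).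
  have e1 : expR (- (1 / 2) * ln 4 - ln (ln 4)) <= 1 :> R.
    rewrite expR_le1; have := ln4_ge1; have := ln_ge0 ln4_ge1; lra.
  have f2' : N (f z) <= 2.
    move: fz4; rewrite /lnN2 -ler_expR !lnK ?posrE ?exprn_gt0 ?N_gt0//.
    by have -> : 4 = 2 ^+ 2 :> R; [rewrite -natrX|rewrite ler_pXn2r ?nnegrE ?N_ge0].
  have X0 : 0 <= N (f' z) * (2 ^+ 2 - N z ^+ 2) by rewrite mulr_ge0 ?N_ge0.
  have := rob_bound z2; have := rob_lower z4 f2'; rewrite -!mulrA.
  move: (N (f' z) * _) X0 => X X0 H1 H2.
  have H3 := ler_wpM2r X0 H1; have H4 := ler_wpM2r X0 e1.
  by lra.
right; have t0 : 0 < lnN2 f z by have := ln4_ge1; lra.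
have [b tf] := taylor fd z4.
have p1 : peano (fun t => - (1 / 2) * t - ln t) (lnN2 f z)
    (- (1 / 2) * 1 - (lnN2 f z)^-1) (0 - - (lnN2 f z ^+ 2)^-1).
  apply: (@peano_rderiv _ _ (fun t => - (1 / 2) * 1 - t^-1) _ _ (lnN2 f z)) => //.
    move=> s; rewrite ltr_norml => /andP[s1 s2].
    apply: rderivB; first by apply: rderivZ; exact: rderiv_id.
    by apply: rderiv_ln; lra.
  by apply: rderivB; [exact: rderiv_const | apply: rderiv_inv; rewrite gt_eqF].
have [al j] := jet_comp_lnN2 fz tf p1.
have c0 := continuous_lnN2 fz (cderiv_continuous (fd z4)).
have [r r0 Hr] : exists2 r, 0 < r & forall w, N (w - z) < r -> ln 4 < lnN2 f w.
  by apply/nbhs_N; apply: (cvgr_gt _ c0).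
exists al; eexists; split.
  apply: (jet_near r0 _ j) => w /Hr w4.
  by rewrite /m (max_idPl (ltW w4)).
rewrite /m (max_idPl (ltW fz4)) mul1r sub0r opprK.
rewrite expRB lnK ?posrE// exprMn exprVn -expRM_natl.
have -> : 2 * (- (1 / 2) * lnN2 f z) = - lnN2 f z by field.
rewrite expRN /lnN2 lnK ?posrE ?exprn_gt0 ?N_gt0//.
by rewrite le_eqVlt; apply/orP; left; apply/eqP; ring.
Qed.

(** The left side is the length of the gradient of ln |f|^2, so ln ln |f|^2 is Lipschitz. The factor
    2 is absorbed by 4 - |z|^2 >= 2. *)
Lemma derivative_bound z : N z < 1 + 1 / 4 -> 2 <= N (f z) ->
  2 * N (f' z) / N (f z) <= (32 * 216) * lnN2 f z.
Proof.
move=> z1 fz2; have z2 : N z < 2 by lra.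
have f0 : 0 < N (f z) by lra.
have l4 : ln 4 <= lnN2 f z.
  rewrite /lnN2 ler_ln ?posrE ?exprn_gt0//.
  by have -> : 4 = 2 ^+ 2 :> R; [rewrite -natrX|rewrite ler_pXn2r ?nnegrE ?N_ge0].
have t0 : 0 < lnN2 f z by have := ln4_ge1; lra.
have := cusp_bound z2; rewrite /m (max_idPl l4).
have q2 : 2 <= 2 ^+ 2 - N z ^+ 2.
  have : N z ^+ 2 <= (5 / 4) ^+ 2 by rewrite ler_pXn2r ?nnegrE ?N_ge0//; lra.
  by rewrite !expr2; lra.
have -> : expR (- (1 / 2) * lnN2 f z - ln (lnN2 f z)) = (N (f z))^-1 / lnN2 f z.
  rewrite expRB lnK ?posrE//; congr (_ / _).
  rewrite -[RHS]lnK ?posrE ?invr_gt0// lnV ?posrE// /lnN2 lnXn//.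
  by congr expR; rewrite mulr2n; field.
move=> H.
have X0 : 0 <= (N (f z))^-1 / lnN2 f z * N (f' z).
  by rewrite !mulr_ge0 ?invr_ge0 ?N_ge0// ltW.
have {}H := le_trans (ler_wpM2l X0 q2) H.
rewrite -ler_pdivrMr//; apply: le_trans H.
by rewrite le_eqVlt; apply/orP; left; apply/eqP; ring.
Qed.

End OmitsTwoValues.

End Schottky.

(** * Integrating the derivative bound along rays *)

Section Growth.
Context {R : realType}.
Implicit Types (f : R[i] -> R[i]) (z w : R[i]).

Lemma rderiv_lnN2_ray f z (s : R) d : f (z * s%:C) != 0 -> cderiv f (z * s%:C) d ->
  exists2 l, rderiv (fun t => lnN2 f (z * t%:C)) s l &
    `|l| <= 2 * (N d * N z) / N (f (z * s%:C)).
Proof.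
move=> f0 fd.
pose g (t : R) := f (z * t%:C).
have gd : pderiv g s (d * z).
  have H : cderiv (fun w => f (0 + z * w)) (s +i* 0) (d * z).
    by apply: cderiv_affine; rewrite add0r.
  have -> : g = fun t => (fun w => f (0 + z * w)) (t +i* 0).
    by apply/funext => t; rewrite /g add0r.
  exact: (pderiv_horizontal H).
have rd := pderiv_Re gd; have id := pderiv_Im gd.
have p0 : 0 < Re (g s) * Re (g s) + Im (g s) * Im (g s).
  by rewrite -!expr2 -N_sqr exprn_gt0// N_gt0.
have pd := rderivD (rderivM rd rd) (rderivM id id).
have ld := rderiv_comp (g := fun t => Re (g t) * Re (g t) + Im (g t) * Im (g t))
  (rderiv_ln p0) pd.
exists ((Re (g s) * Re (g s) + Im (g s) * Im (g s))^-1 *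
    (Re (g s) * Re (d * z) + Re (g s) * Re (d * z) +
    (Im (g s) * Im (d * z) + Im (g s) * Im (d * z)))).
  have -> : (fun t => lnN2 f (z * t%:C)) =
      fun t => ln (Re (g t) * Re (g t) + Im (g t) * Im (g t)).
    by apply/funext => t; rewrite /lnN2 N_sqr !expr2.
  exact: ld.
rewrite -!expr2 -N_sqr -/(g s).
have gs0 : 0 < N (g s) by rewrite N_gt0.
have -> : Re (g s) * Re (d * z) + Re (g s) * Re (d * z) +
    (Im (g s) * Im (d * z) + Im (g s) * Im (d * z)) =
    2 * Re (conjc (g s) * (d * z)).
  by rewrite [Re (conjc _ * _)]cReM cReJ cImJ; ring.
rewrite normrM (ger0_norm (_ : 0 <= (N (g s) ^+ 2)^-1)) ?invr_ge0 ?sqr_ge0//.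
rewrite normrM (@ger0_norm _ 2)//.
have H : `|Re (conjc (g s) * (d * z))| <= N (g s) * (N d * N z).
  by apply: le_trans (Re_le_N _) _; rewrite NM NJ NM.
have -> : 2 * (N d * N z) / N (g s) = (N (g s) ^+ 2)^-1 * (2 * (N (g s) * (N d * N z))).
  by field; rewrite gt_eqF.
by rewrite ler_wpM2l ?invr_ge0 ?sqr_ge0// ler_wpM2l.
Qed.

(** A Gronwall argument on the ray from 0 to z: wherever l = ln |f|^2 is at least [T], it satisfies
    l' <= A l. *)
Lemma log_growth f (f' : R[i] -> R[i]) z (T : R) :
  (forall z, N z < 4 -> cderiv f z (f' z)) ->
  (forall z, N z < 4 -> f z != 0 /\ f z != 1) ->
  N z <= 1 -> ln 4 <= T -> lnN2 f 0 <= T ->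
  lnN2 f z <= T * expR (32 * 216 + 1).
Proof.
move=> fd f01 z1 T4 f0T.
have Ad := derivative_bound fd f01.
have [A [A0 AE]] : exists A : R, 0 < A /\ A = 32 * 216 by exists (32 * 216); split => //; lra.
rewrite -AE in Ad *.
have T0 : 0 < T by have := @ln4_ge1 R; lra.
pose l (s : R) := lnN2 f (z * s%:C).
have zs s : 0 <= s <= 1 -> N (z * s%:C) <= 1.
  by move=> /andP[s0 s1]; rewrite NM NR ger0_norm// mulr_ile1 ?N_ge0.
have zs4 s : 0 <= s <= 1 -> N (z * s%:C) < 4 by move=> /zs; lra.
have ld s : 0 <= s <= 1 -> exists2 d, rderiv l s d & T <= l s -> d <= A * l s.
  move=> s01; have s4 := zs4 _ s01; have [fn0 _] := f01 _ s4.
  have [d ld dle] := rderiv_lnN2_ray fn0 (fd _ s4); exists d => // Tl.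
  have f2 : 2 <= N (f (z * s%:C)).
    have : 4 <= N (f (z * s%:C)) ^+ 2.
      by rewrite -ler_ln ?posrE ?exprn_gt0 ?N_gt0//; apply: le_trans T4 Tl.
    have -> : 4 = 2 ^+ 2 :> R by rewrite -natrX.
    by rewrite ler_pXn2r ?nnegrE ?N_ge0.
  apply: le_trans (ler_norm _) _; apply: le_trans dle _.
  have s1 : N (z * s%:C) < 1 + 1 / 4 by have := zs _ s01; lra.
  apply: le_trans (Ad _ s1 f2).
  rewrite ler_wpM2r ?invr_ge0 ?N_ge0// ler_wpM2l// -[leRHS]mulr1.
  by rewrite ler_wpM2l ?N_ge0.
(* The slope [A + 1], larger than [A], gives [h] a derivative at most -1 where [l > T]; a small step
   back would increase [h], so its maximum over [0, 1] is attained where [l <= T]. *)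
pose h s := ln (Num.max (l s) T) - (A + 1) * s.
have m0 s : 0 < Num.max (l s) T by rewrite lt_max T0 orbT.
have ch : {within `[0, 1], continuous h}.
  apply: continuous_in_subspaceT => s; rewrite inE/= in_itv/= => s01.
  have [d dl _] := ld _ s01.
  have cm : {for s, continuous (fun s => Num.max (l s) T)}.
    apply: (@continuous_max _ _ l (cst T)); last exact: cst_continuous.
    exact: rderiv_continuous dl.
  have c1 := continuous_comp cm (rderiv_continuous (rderiv_ln (m0 s))).
  have c2 : {for s, continuous (fun s => (A + 1) * s)}.
    exact: (rderiv_continuous (rderivZ (A + 1) (rderiv_id s))).
  exact: (continuousB c1 c2).
have [s /[!in_itv]/= s01 hmax] := EVT_max ler01 ch.
have ls : l s <= T.
  rewrite leNgt; apply/negP => Tl.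
  have s0 : 0 < s.
    rewrite lt_def; case/andP: s01 => -> _; rewrite andbT; apply/eqP => s0.
    by move: Tl; rewrite s0 /l mulr0 ltNge f0T.
  have [d dl dle] := ld _ s01.
  have l0 : 0 < l s by lra.
  have [r r0 Hr] : exists2 r, 0 < r & forall t, `|t - s| < r -> T < l t.
    have : \forall t \near s, T < l t by apply: (cvgr_gt _ (rderiv_continuous dl)).
    by move=> [r /= r0 Hr]; exists r => // t ts; apply: Hr; rewrite /= distrC.
  have hd : rderiv h s ((l s)^-1 * d - (A + 1) * 1).
    apply: (@rderiv_near _ (fun s => ln (l s) - (A + 1) * s) _ _ _ r) => //.
      by move=> t /Hr Tt; rewrite /h (max_idPl (ltW Tt)).
    apply: rderivB; last by apply: rderivZ; exact: rderiv_id.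
    by apply: rderiv_comp => //; exact: rderiv_ln.
  have dneg : (l s)^-1 * d - (A + 1) * 1 <= - 1.
    have : (l s)^-1 * d <= A by rewrite mulrC ler_pdivrMr// dle// ltW.
    by lra.
  move: hd dneg; move: (_ - _) => D hd dneg.
  have [q q0 Hq] := hd (1 / 2) (divr_gt0 ltr01 (ltr0Sn _ 1)).
  pose t := Num.min q s / 2.
  have q1 : 0 < Num.min q s by rewrite lt_min q0.
  have t0 : 0 < t by rewrite divr_gt0.
  have : t < Num.min q s by rewrite /t; lra.
  rewrite lt_min => /andP[tq ts].
  clearbody t.
  have st01 : s - t \in `[0, 1] by rewrite in_itv/=; case/andP: s01 => *; apply/andP; split; lra.
  have := Hq (- t); rewrite normrN gtr0_norm// => /(_ tq).
  have := hmax _ st01; rewrite ler_norml => H1 /andP[H2 _].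
  have : 0 <= (- 1 - D) * t by rewrite mulr_ge0 ?subr_ge0 ?(ltW t0).
  by lra.
have i1 : 1 \in `[0, 1 : R] by rewrite in_itv/= ler01 lexx.
have := hmax _ i1; rewrite /h (max_idPr ls) mulr1 => H.
have {}H : ln (Num.max (l 1) T) <= ln T + (A + 1).
  have : 0 <= (A + 1) * s by case/andP: s01 => s0 _; rewrite mulr_ge0//; lra.
  by lra.
have -> : lnN2 f z = l 1 by rewrite /l mulr1.
apply: (@le_trans _ _ (Num.max (l 1) T)); first by rewrite le_max lexx.
by rewrite -[leLHS]lnK ?posrE// -[X in X * _](lnK (x := T)) ?posrE// -expRD ler_expR.
Qed.

Lemma schottky (K : R) : exists2 C, 0 < C & forall f (f' : R[i] -> R[i]) z,
  (forall z, N z < 4 -> cderiv f z (f' z)) ->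
  (forall z, N z < 4 -> f z != 0 /\ f z != 1) ->
  N (f 0) <= K -> N z <= 1 -> N (f z) <= C.
Proof.
pose T := Num.max (ln 4) (ln (K ^+ 2)).
exists (1 + expR (T * expR (32 * 216 + 1))); first by rewrite addr_gt0// expR_gt0.
move=> f f' z fd f01 f0K z1.
have N04 : N (0 : R[i]) < 4 by rewrite N0.
have [f00 _] := f01 _ N04.
have z4 : N z < 4 by lra.
have [fz0 _] := f01 _ z4.
have T1 : ln 4 <= T by rewrite le_max lexx.
have T2 : lnN2 f 0 <= T.
  rewrite /T le_max; apply/orP; right; rewrite /lnN2.
  have k0 : 0 < K by apply: lt_le_trans f0K; rewrite N_gt0.
  by rewrite ler_ln ?posrE ?exprn_gt0 ?N_gt0// ler_pXn2r ?nnegrE ?N_ge0 ?(ltW k0).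
have := log_growth fd f01 z1 T1 T2.
move: (_ * expR _) => E; rewrite -ler_expR /lnN2 lnK ?posrE ?exprn_gt0 ?N_gt0// => H.
(* |f| is recovered from |f|^2 <= E through 2 |f| <= |f|^2 + 1. *)
have := N_ge0 (f z); have := expR_ge0 E; have := sqr_ge0 (N (f z) - 1).
by move: (expR E) H => {}E; rewrite !expr2; nra.
Qed.

End Growth.

(** * Domains in several variables *)

Section Domains.
Context {R : realType} {n : nat}.
Implicit Types (Omega : set 'rV[R[i]]_n) (f : 'rV[R[i]]_n -> R[i]) (z w p v : 'rV[R[i]]_n).

Definition polydisc z (r : R) : set 'rV[R[i]]_n :=
  [set w | forall i, N (w ord0 i - z ord0 i) < r].

Lemma nbhs_polydisc z (A : set 'rV[R[i]]_n) :
  nbhs z A <-> exists2 r, 0 < r & polydisc z r `<=` A.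
Proof.
split=> [/nbhs_ballP[r /= r0 H]|[r r0 H]].
  move: r0 H; rewrite ltcE; case: r => r ri /= /andP[/eqP -> r0] H.
  exists r => // w wz; apply: H; split; first by rewrite ltcR.
  by move=> i j; rewrite (ord1 i) /ball /= normE ltcR NBC; exact: wz.
apply/nbhs_ballP; exists r%:C => /=; first by rewrite ltcR.
move=> w [_ wz]; apply: H => i.
by have := wz ord0 i; rewrite /ball /= normE ltcR NBC.
Qed.

Lemma holomorphic_on_line Omega f p v (c : R[i]) : holomorphic_on Omega f ->
  Omega (p + c *: v) -> exists d, cderiv (fun c => f (p + c *: v)) c d.
Proof.
move=> hf /hf fd.
have /cvg_ex[d {}fd] : derivable f (p + c *: v) v by exact: diff_derivable.
exists d.
pose g (c : R[i]) : R[i] := f (p + c *: v).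
have H : h^-1 *: ((g \o shift c) (h *: 1) - g c) @[h --> 0^'] --> d.
  apply: cvg_trans fd; apply: near_eq_cvg; near=> h => /=.
  by rewrite /g [h *: 1]mulr1 scalerDl addrCA.
have df : derivable g c 1 by apply/cvg_ex; exists d.
apply/cderivP; apply: (DeriveDef df).
by apply: cvg_lim H; exact: norm_hausdorff.
Unshelve. all: by end_near. Qed.

Definition omits01 Omega f := forall z, Omega z -> f z <> 0 /\ f z <> 1.

(** Restrict f to the complex line c -> z + c (w - z); for |c| < 4 it stays in the polydisc, as 4 *
    r / 5 < r. The constant is chosen before [Omega], [f], [z] and [r], so the same one serves
    around every point. *)
Lemma schottky_polydisc (K : R) : exists2 C, 0 < C & forall Omega f z (r : R) w,
  0 < r -> polydisc z r `<=` Omega -> holomorphic_on Omega f -> omits01 Omega f ->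
  N (f z) <= K -> (forall i, N (w ord0 i - z ord0 i) <= r / 5) -> N (f w) <= C.
Proof.
have [C C0 HC] := @schottky R K; exists C => // Omega f z r w r0 zr hf f01 fz wz.
pose g c := f (z + c *: (w - z)).
have in4 c : N c < 4 -> Omega (z + c *: (w - z)).
  move=> c4; apply: zr => i; rewrite !mxE addrAC subrr add0r NM.
  apply: le_lt_trans (ler_wpM2l (N_ge0 _) (wz i)) _.
  have : N c * (r / 5) <= 4 * (r / 5) by rewrite ler_wpM2r ?ltW// divr_gt0.
  by lra.
pose g' c := xget 0 [set d | cderiv g c d].
have gd c : N c < 4 -> cderiv g c (g' c).
  by move=> /in4 /(holomorphic_on_line hf); exact: (@xgetPex _ 0).
have := HC g g' 1 gd.
rewrite N1 /g scale0r addr0 scale1r (addrC z) subrK; apply => // c c4.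
by have [/eqP ? /eqP ?] := f01 _ (in4 _ c4).
Qed.

Definition uniformly_bounded_at Omega (a : 'rV[R[i]]_n) (b : R[i]) (C : R) z :=
  forall f, holomorphic_on Omega f -> omits01 Omega f -> f a = b -> N (f z) <= C.

Lemma uniformly_bounded_polydisc (K : R) : exists2 C, 0 < C &
  forall Omega a b z (r : R) w, 0 < r -> polydisc z r `<=` Omega ->
  (forall i, N (w ord0 i - z ord0 i) <= r / 5) ->
  uniformly_bounded_at Omega a b K z -> uniformly_bounded_at Omega a b C w.
Proof.
have [C C0 HC] := schottky_polydisc K; exists C => // Omega a b z r w r0 zr wz zK.
by move=> f hf f01 fa; exact: (HC Omega f z r w r0 zr hf f01 (zK f hf f01 fa) wz).
Qed.

Lemma polydiscS z (r s : R) : r <= s -> polydisc z r `<=` polydisc z s.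
Proof. by move=> rs w wz i; exact: lt_le_trans (wz i) rs. Qed.

Lemma polydisc_trans z w (r s : R) : polydisc z r w ->
  polydisc w s `<=` polydisc z (r + s).
Proof.
move=> wz v vw i.
have -> : v ord0 i - z ord0 i = (v ord0 i - w ord0 i) + (w ord0 i - z ord0 i) by ring.
by apply: le_lt_trans (ND _ _) _; rewrite addrC ltrD// ?wz ?vw.
Qed.

Lemma polydisc_sym z w (r : R) : polydisc z r w -> polydisc w r z.
Proof. by move=> wz i; rewrite NBC. Qed.

(** The points with a uniform bound include [a], where f(a) = b, and form an open and closed subset
    of Omega: bounds pass from a point to its neighbours, and from a nearby point to a limit
    point. *)
Lemma uniformly_bounded_domain Omega (a : 'rV[R[i]]_n) (b : R[i]) :
  is_domain Omega -> Omega a ->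
  forall z, Omega z -> exists C, uniformly_bounded_at Omega a b C z.
Proof.
move=> [_ oO cO] Oa.
pose B := [set z | Omega z /\ exists C, uniformly_bounded_at Omega a b C z].
suff : B = Omega by move=> BO z; rewrite -{1}BO => -[].
have disc z : Omega z -> exists2 r, 0 < r & polydisc z r `<=` Omega.
  by move=> Oz; apply/nbhs_polydisc; exact: open_nbhs_nbhs.
apply: cO.
- by exists a; split => //; exists (N b) => f _ _ ->.
- exists B; last by apply/seteqP; split=> [z [Oz ?]|z []//].
  rewrite openE => z [Oz [K zK]]; have [r r0 zr] := disc _ Oz.
  have [C C0 HC] := uniformly_bounded_polydisc K.
  apply/nbhs_polydisc; exists (r / 5); first by rewrite divr_gt0.
  move=> w wz; split; last first.
    by exists C; apply: (HC Omega a b z r w r0 zr _ zK) => i; rewrite ltW.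
  by apply: zr; apply: polydiscS wz; lra.
- exists (closure B); first exact: closed_closure.
  apply/seteqP; split=> [z Bz|z [Oz Bz]].
    by split; [exact: Bz.1 | exact: subset_closure].
  split=> //; have [r r0 zr] := disc _ Oz.
  (* The polydisc of radius r / 2 around [w] still lies in Omega, and [z] is within (r / 2) / 5 = r
     / 10 of [w]. *)
  have r20 : 0 < r / 10 by rewrite divr_gt0.
  have [w [[Ow [K wK]] wz]] : B `&` polydisc z (r / 10) !=set0.
    by apply: Bz; apply/nbhs_polydisc; exists (r / 10).
  have [C C0 HC] := uniformly_bounded_polydisc K.
  exists C; apply: (HC Omega a b w (r / 2) z _ _ _ wK); first by rewrite divr_gt0.
    apply: subset_trans zr; apply: subset_trans (polydisc_trans wz) _.
    by apply: polydiscS; lra.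
  move=> i; rewrite NBC; apply: le_trans (ltW (wz i)) _; lra.
Qed.

Lemma uniformly_bounded_near Omega (a : 'rV[R[i]]_n) (b : R[i]) :
  is_domain Omega -> Omega a -> forall z, Omega z -> exists2 r, 0 < r &
  exists C, forall w, polydisc z r w -> uniformly_bounded_at Omega a b C w.
Proof.
move=> dO Oa z Oz; have [K zK] := uniformly_bounded_domain b dO Oa Oz.
have [C C0 HC] := uniformly_bounded_polydisc K.
have [_ oO _] := dO.
have [r r0 zr] : exists2 r, 0 < r & polydisc z r `<=` Omega.
  by apply/nbhs_polydisc; exact: open_nbhs_nbhs.
exists (r / 5); first by rewrite divr_gt0.
exists C.
by move=> w wz; apply: (HC Omega a b z r w r0 zr _ zK) => i; rewrite ltW.
Qed.

(** Bounds hold locally and survive enlarging C, so compactness in its near-covering form applies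
    along C -> +oo. *)
Lemma uniformly_bounded_compact Omega (a : 'rV[R[i]]_n) (b : R[i]) (A : set 'rV[R[i]]_n) :
  is_domain Omega -> Omega a -> compact A -> A `<=` Omega ->
  exists2 C, 0 < C & forall z, A z -> uniformly_bounded_at Omega a b C z.
Proof.
move=> dO Oa /compact_near_coveringP cA AO.
have := cA _ (@pinfty_nbhs R) (fun C z => uniformly_bounded_at Omega a b C z) _ _.
have H z : A z -> \forall z' \near z & C \near +oo, uniformly_bounded_at Omega a b C z'.
  move=> /AO /(uniformly_bounded_near b dO Oa) [r r0 [C HC]].
  exists (polydisc z r, [set D | C <= D]).
    split; first by apply/nbhs_polydisc; exists r.
    by exists C; split; [exact: num_real | move=> x; exact: ltW].
  move=> [w D] [/= wz CD] f hf f01 fa.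
  by apply: le_trans CD; exact: HC.
move=> /(_ _ H)[C [_ HC]].
exists (`|C| + 1); first by rewrite ltr_wpDl.
by apply: HC; rewrite (le_lt_trans (ler_norm _))// ltrDl.
Qed.

Lemma euclidean_dist_polydisc z w (e : R) : 0 < e ->
  polydisc z (e / n.+1%:R) w -> euclidean_dist z w < e.
Proof.
move=> e0 wz; rewrite /euclidean_dist.
(* Dividing by n + 1 gives strictness, as n < (n + 1)^2, and is safe for n = 0. *)
pose d := e / n.+1%:R; have d0 : 0 < d by rewrite divr_gt0.
have eE : e = n.+1%:R * d by rewrite /d mulrCA mulfV ?mulr1// pnatr_eq0.
have {}wz : polydisc z d w by [].
clearbody d.
rewrite -[ltRHS]ger0_norm ?ltW// -sqrtr_sqr ltr_sqrt ?exprn_gt0//.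
apply: (@le_lt_trans _ _ (n%:R * d ^+ 2)).
  have -> : n%:R * d ^+ 2 = \sum_(i < n) d ^+ 2 by rewrite sumr_const card_ord mulr_natl.
  apply: ler_sum => i _.
  by rewrite NBC ler_pXn2r ?nnegrE ?N_ge0 ?ltW//; exact: wz.
rewrite eE exprMn ltr_pM2r ?exprn_gt0// -natrX ltr_nat.
by rewrite (leq_trans (ltnSn n))// -mulnn leq_pmulr.
Qed.

Lemma dist_to_boundary_le Omega z w :
  boundary Omega w -> dist_to_boundary Omega z <= euclidean_dist z w.
Proof.
move=> bw; apply: ge_inf; last by exists w.
by exists 0 => _ [v _ <-]; exact: sqrtr_ge0.
Qed.

Lemma closure_polydisc (A : set 'rV[R[i]]_n) z (r : R) : 0 < r -> closure A z ->
  exists2 w, A w & polydisc z r w.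
Proof.
move=> r0 /(_ (polydisc z r))[]; first by apply/nbhs_polydisc; exists r.
by move=> w [Aw wz]; exists w.
Qed.

(** A limit point outside Omega would be a boundary point, yet points of the set would come closer
    to it than [e]. *)
Lemma closure_inner_subset Omega (e : R) : open Omega -> 0 < e ->
  closure [set z | Omega z /\ e <= dist_to_boundary Omega z] `<=` Omega.
Proof.
move=> oO e0 z cz; apply: contrapT => nOz.
have bz : boundary Omega z.
  split; last by move=> /interior_subset.
  by move: z cz {nOz}; apply: closureS => z [].
have d0 : 0 < e / n.+1%:R by rewrite divr_gt0.
have [w [Ow ew] wz] := closure_polydisc d0 cz.
have := euclidean_dist_polydisc e0 (polydisc_sym wz).
by rewrite ltNge (le_trans ew)// dist_to_boundary_le.
Qed.

Lemma bounded_coord Omega : bounded_set Omega ->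
  exists M : R, forall z, Omega z -> forall i, N (z ord0 i) <= M.
Proof.
(* The bound [M] lives in R[i]; being positive it is real, and [Re M] represents it. *)
move=> /ex_strict_bound_gt0[M M0 HM]; exists (Re M) => z Oz i.
have /= zM := HM _ Oz.
have : ball (0 : 'rV[R[i]]_n) M z by rewrite mx_norm_ball /ball_ /= sub0r normrN.
move=> [_ /(_ ord0 i)]; rewrite /ball /= mxE sub0r normrN normE.
by rewrite ltcE /= => /andP[_ /ltW].
Qed.

Lemma closed_bounded_compact (A : set 'rV[R[i]]_n) (M : R) : closed A ->
  (forall z, A z -> forall i, N (z ord0 i) <= M) -> compact A.
Proof.
move=> cA AM.
pose box := [set v : 'rV[R[i]]_n | forall i, [set c : R[i] | rect (- M) M (- M) M c] (v ord0 i)].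
apply: (@subclosed_compact _ _ box) => //.
  apply: (@rV_compact _ n (fun=> [set c : R[i] | rect (- M) M (- M) M c])) => i.
  exact: compact_rect.
move=> z Az i /=; split; rewrite -ler_norml; apply: le_trans (AM _ Az i).
  exact: Re_le_N.
exact: Im_le_N.
Qed.

End Domains.

Theorem theorem0p1 (R : realType) (n : nat) (n_ge1 : (1 <= n)%N)
    (Omega : set 'rV[R[i]]_n) (Omega_domain : is_domain Omega)
    (Omega_bounded : bounded_set Omega)
    (a : 'rV[R[i]]_n) (Omega_a : Omega a) (M : R) (M_gt0 : 0 < M) :
  exists2 eps0 : R, 0 < eps0 &
  forall eps : R, 0 < eps -> eps < eps0 ->
  forall w : R[i], `|w| < M%:C ->
  exists2 C : R, 0 < C &
  forall f : 'rV[R[i]]_n -> R[i],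
    holomorphic_on Omega f ->
    (forall z, Omega z -> f z <> 0 /\ f z <> 1) ->
    f a = w ->
    forall z, Omega z -> eps <= dist_to_boundary Omega z -> `|f z| < C%:C.
Proof.
(* The compactness argument runs for every positive [eps]; 1 is an arbitrary threshold. *)
exists 1 => // eps eps0 _ w _.
have [_ oO _] := Omega_domain.
pose A := [set z | Omega z /\ eps <= dist_to_boundary Omega z].
(* Passing to the closure gives a closed set without a proof that delta is continuous. *)
have AO : closure A `<=` Omega := closure_inner_subset oO eps0.
have [B OB] := bounded_coord Omega_bounded.
have cA : compact (closure A).
  by apply: (closed_bounded_compact (@closed_closure _ A)) => z /AO; exact: OB.
have [C C0 HC] := uniformly_bounded_compact w Omega_domain Omega_a cA AO.
(* Adding 1 makes the inequality strict. *)
exists (C + 1) => [|f hf f01 fa z Oz zeps]; first by rewrite addr_gt0.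
rewrite normE ltcR; apply: le_lt_trans (_ : C < C + 1); last by rewrite ltrDl.
by apply: HC => //; apply: subset_closure.
Qed.
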